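(* In the constrained Lasso setting of the context, with $x\in\mathbb{R}^n$ and $\sigma>0$ fixed, let $(\hat u,\hat v)$ be an accumulation point of the sequence $\{(u^j,v^j)\}$ generated by Algorithm 2 (the semismooth Newton method described in the context, with parameter $\tau\in(0,1]$). Suppose that the constraint nondegeneracy condition holds at $\hat z=x-\sigma(A^T\hat u-B^T\hat v)$. Then the sequence $\{(u^j,v^j)\}$ converges to $(\hat u,\hat v)$ and $$\|(u^{j+1},v^{j+1})-(\hat u,\hat v)\|=\mathcal{O}\big(\|(u^j,v^j)-(\hat u,\hat v)\|^{1+\tau}\big).$$
   Context: Let $A\in\mathbb{R}^{m\times n}$, $b\in\mathbb{R}^m$, $B\in\mathbb{R}^{s\times n}$, $d\in\mathbb{R}^s$, $\lambda>0$; $h^*(u)=\frac12\|u\|^2+b^Tu$, $p(x)=\lambda\|x\|_1$ and $p^*$ its conjugate. For $\sigma>0$ let $\mathcal{L}_\sigma(u,v,w;x)=h^*(u)-\langle v,d\rangle+p^*(w)-\langle x,A^Tu-B^Tv+w\rangle+\frac{\sigma}{2}\|A^Tu-B^Tv+w\|^2$. For fixed $x$ and $\sigma$, and $y=(u,v)\in\mathbb{R}^{m+s}$, let $\theta(y)=\theta(u,v)=\inf_w\mathcal{L}_\sigma(u,v,w;x)$. With $\bar A=\begin{bmatrix}A\\-B\end{bmatrix}$ (so $\bar A^Ty=A^Tu-B^Tv$) and $\mathrm{Prox}_{\sigma p}(z)=\mathrm{argmin}_{t}\{\sigma p(t)+\frac12\|t-z\|^2\}$ (soft-thresholding at level $\sigma\lambda$),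 $\theta$ is convex and continuously differentiable with $$\nabla\theta(y)=\begin{bmatrix}u+b-A\,\mathrm{Prox}_{\sigma p}(x-\sigma\bar A^Ty)\\-d+B\,\mathrm{Prox}_{\sigma p}(x-\sigma\bar A^Ty)\end{bmatrix}.$$ $\partial\mathrm{Prox}_{\sigma p}(\cdot)$ denotes the Clarke subdifferential (generalized Jacobian). Algorithm 2 (semismooth Newton). Input: $\mu\in(0,1/2)$, $\bar\eta\in(0,1)$, $\tau\in(0,1]$, $\tau_1,\tau_2\in(0,1)$, $\delta\in(0,1)$, and a starting point $y^0=(u^0,v^0)$. For $j=0,1,\dots$: (1) Choose $Q^j\in\partial\mathrm{Prox}_{\sigma p}(x-\sigma\bar A^Ty^j)$, let $V_j=\begin{bmatrix}I_m&0\\0&0\end{bmatrix}+\sigma\bar AQ^j\bar A^T$ and $\epsilon_j=\tau_1\min\{\tau_2,\|\nabla\theta(y^j)\|\}$. Solve the linear system $V_j(d_u,d_v)+\epsilon_j(0,d_v)=-\nabla\theta(y^j)$ exactly, or by the conjugate gradient (CG) algorithm, to find an approximate solution $(d_u^j,d_v^j)$ with $\|V_j(d_u^j,d_v^j)+\epsilon_j(0,d_v^j)+\nabla\theta(y^j)\|\le\min(\bar\eta,\|\nabla\theta(y^j)\|^{1+\tau})$. (2) (Line search) Set $\alpha_j=\delta^{l_j}$, where $l_j$ is the first nonnegative integer $l$ for which $\theta(u^j+\delta^ld_u^j,v^j+\delta^ld_v^j)\le\theta(u^j,v^j)+\mu\delta^l\langle\nabla\theta(y^j),(d_u^j,d_v^j)\rangle$.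 (3) Set $u^{j+1}=u^j+\alpha_jd_u^j$, $v^{j+1}=v^j+\alpha_jd_v^j$, $y^{j+1}=(u^{j+1},v^{j+1})$. Constraint nondegeneracy: for $z\in\mathbb{R}^n$ let $\hat Q=\mathrm{diag}(\hat q)\in\partial\mathrm{Prox}_{\sigma\lambda\|\cdot\|_1}(z)$ with $\hat q_i=1$ if $|z_i|>\sigma\lambda$ and $\hat q_i=0$ otherwise. The constraint nondegeneracy condition holds at $z$ if $\mathrm{lin}(B\hat Q)=\mathbb{R}^s$, where $\mathrm{lin}(B\hat Q)$ is the linear space spanned by the columns of $B\hat Q$. *)

(* Defs.v *)
From HB Require Import structures.
From mathcomp Require Import all_boot all_order all_algebra.
From mathcomp Require Import all_classical all_reals all_analysis.

Set Implicit Arguments.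
Unset Strict Implicit.
Unset Printing Implicit Defensive.

Import Order.TTheory GRing.Theory Num.Theory.
Import numFieldNormedType.Exports.

Local Open Scope classical_set_scope.
Local Open Scope ring_scope.

(* The library's norm `|x| on matrices is the sup norm, hence [enorm]. *)
Definition dot (R : realType) (k : nat) (x y : 'cV[R]_k) : R :=
  (x^T *m y) 0 0.

Definition enorm (R : realType) (k : nat) (x : 'cV[R]_k) : R :=
  Num.sqrt (dot x x).

Definition l1norm (R : realType) (k : nat) (x : 'cV[R]_k) : R :=
  \sum_(i < k) `|x i 0|.

Definition gradient (R : realType) (k : nat) (f : 'cV[R]_k -> R)
    (y : 'cV[R]_k) : 'cV[R]_k :=
  \col_i 'D_(delta_mx i 0) (f : 'cV[R]_k -> R^o) y.

Definition conjugate (R : realType) (k : nat) (f : 'cV[R]_k -> R)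
    (w : 'cV[R]_k) : \bar R :=
  ereal_sup [set (dot w t - f t)%:E | t in [set: 'cV[R]_k]].

(* For [f] convex the minimizer exists and is unique; otherwise [get] may
   return an arbitrary minimizer, or a default value if there is none. *)
Definition prox (R : realType) (k : nat) (f : 'cV[R]_k -> R)
    (z : 'cV[R]_k) : 'cV[R]_k :=
  get [set t | forall t', f t + 2^-1 * enorm (t - z) ^+ 2
                          <= f t' + 2^-1 * enorm (t' - z) ^+ 2].

(* The library's [jacobian] is for row vectors acting on the left; this one is
   the usual matrix of partial derivatives (row [i] for component [i]). *)
Definition cjacobian (R : realType) (k l : nat) (F : 'cV[R]_k -> 'cV[R]_l)
    (z : 'cV[R]_k) : 'M[R]_(l, k) :=
  \matrix_(i, j) ('D_(delta_mx j 0) F z) i 0.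

Definition bsubdiff (R : realType) (k l : nat) (F : 'cV[R]_k -> 'cV[R]_l)
    (z : 'cV[R]_k) : set 'M[R]_(l, k) :=
  [set M | exists2 zs : nat -> 'cV[R]_k,
     (forall i, differentiable F (zs i)) /\ zs @ \oo --> z
     & (fun i => cjacobian F (zs i)) @ \oo --> M].

Definition clarke (R : realType) (k l : nat) (F : 'cV[R]_k -> 'cV[R]_l)
    (z : 'cV[R]_k) : set 'M[R]_(l, k) :=
  [set Q | exists (N : nat) (c : 'I_N -> R) (M : 'I_N -> 'M[R]_(l, k)),
     [/\ forall i, 0 <= c i, \sum_i c i = 1,
         forall i, bsubdiff F z (M i) & Q = \sum_i c i *: M i]].

(* State (iterate, residual, search direction) of the conjugate gradient
   method for [H *m e = g], started from the zero vector.  Since [0^-1 = 0],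
   the state is stationary once the residual vanishes. *)
Definition cg_step (R : realType) (k : nat) (H : 'M[R]_k)
    (st : 'cV[R]_k * 'cV[R]_k * 'cV[R]_k) : 'cV[R]_k * 'cV[R]_k * 'cV[R]_k :=
  let: (e, r, p) := st in
  let a := dot r r / dot p (H *m p) in
  let r' := r - a *: (H *m p) in
  (e + a *: p, r', r' + (dot r' r' / dot r r) *: p).

Definition cg_iterate (R : realType) (k : nat) (H : 'M[R]_k) (g : 'cV[R]_k)
    (i : nat) : 'cV[R]_k :=
  (iter i (cg_step H) (0, g, g)).1.1.

Section ConstrainedLasso.
Variables (R : realType) (m n s : nat).
Variables (A : 'M[R]_(m, n)) (b : 'cV[R]_m) (B : 'M[R]_(s, n)) (d : 'cV[R]_s).
Variables (lambda sigma : R) (x : 'cV[R]_n).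

Definition hstar (u : 'cV[R]_m) : R := 2^-1 * enorm u ^+ 2 + dot b u.

Definition lasso_reg (t : 'cV[R]_n) : R := lambda * l1norm t.

Definition auglag (u : 'cV[R]_m) (v : 'cV[R]_s) (w : 'cV[R]_n) : \bar R :=
  let r := A^T *m u - B^T *m v + w in
  ((hstar u - dot v d)%:E + conjugate lasso_reg w - (dot x r)%:E
   + (sigma / 2 * enorm r ^+ 2)%:E)%E.

(* A vector [y : 'cV_(m + s)] stands for the pair [(usubmx y, dsubmx y)].
   The infimum is finite when [0 < lambda] and [0 < sigma], so [fine] loses
   nothing. *)
Definition theta (y : 'cV[R]_(m + s)) : R :=
  fine (ereal_inf [set auglag (usubmx y) (dsubmx y) w | w in [set: 'cV[R]_n]]).

Definition Abar : 'M[R]_(m + s, n) := col_mx A (- B).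

Definition lasso_prox : 'cV[R]_n -> 'cV[R]_n :=
  prox (fun t => sigma * lasso_reg t).

Definition prox_arg (y : 'cV[R]_(m + s)) : 'cV[R]_n :=
  x - sigma *: (Abar^T *m y).

Definition newton_mx (Q : 'M[R]_n) : 'M[R]_(m + s) :=
  block_mx 1%:M 0 0 0 + sigma *: (Abar *m Q *m Abar^T).

Definition newton_reg (tau1 tau2 : R) (y : 'cV[R]_(m + s)) : R :=
  tau1 * Num.min tau2 (enorm (gradient theta y)).

(* The map [e |-> newton_mx Q *m e + newton_reg tau1 tau2 y *: (0, dsubmx e)]
   as a matrix. *)
Definition newton_sys (tau1 tau2 : R) (y : 'cV[R]_(m + s)) (Q : 'M[R]_n) :
    'M[R]_(m + s) :=
  newton_mx Q + newton_reg tau1 tau2 y *: block_mx 0 0 0 1%:M.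

Definition newton_dir (etabar tau tau1 tau2 : R) (y : 'cV[R]_(m + s))
    (Q : 'M[R]_n) (e : 'cV[R]_(m + s)) : Prop :=
  let H := newton_sys tau1 tau2 y Q in
  let g := gradient theta y in
  (H *m e = - g \/ exists i, e = cg_iterate H (- g) i) /\
  enorm (H *m e + g) <= Num.min etabar (enorm g `^ (1 + tau)).

Definition armijo (mu delta : R) (y e : 'cV[R]_(m + s)) (l : nat) : Prop :=
  theta (y + delta ^+ l *: e)
    <= theta y + mu * delta ^+ l * dot (gradient theta y) e.

Definition ssn_step (mu etabar tau tau1 tau2 delta : R)
    (y y' : 'cV[R]_(m + s)) : Prop :=
  exists (Q : 'M[R]_n) (e : 'cV[R]_(m + s)) (l : nat),
    [/\ clarke lasso_prox (prox_arg y) Q,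
        newton_dir etabar tau tau1 tau2 y Q e,
        armijo mu delta y e l,
        forall l', (l' < l)%N -> ~ armijo mu delta y e l'
      & y' = y + delta ^+ l *: e].

Definition ssn_sequence (mu etabar tau tau1 tau2 delta : R)
    (y : nat -> 'cV[R]_(m + s)) : Prop :=
  forall j, ssn_step mu etabar tau tau1 tau2 delta (y j) (y j.+1).

Definition Qhat (z : 'cV[R]_n) : 'M[R]_n :=
  diag_mx (\row_i (if sigma * lambda < `|z i 0| then 1 else 0)).

Definition constraint_nondegenerate (z : 'cV[R]_n) : Prop :=
  <<codom (fun j => col j (B *m Qhat z))>>%VS = fullv.

End ConstrainedLasso.

(* Main.v *)
Require Import Defs.
From HB Require Import structures.
From mathcomp Require Import all_boot all_order all_algebra.
From mathcomp Require Import all_classical all_reals all_analysis.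
From mathcomp Require Import ring lra.

Set Implicit Arguments.
Unset Strict Implicit.
Unset Printing Implicit Defensive.

Import Order.TTheory GRing.Theory Num.Theory.
Import numFieldNormedType.Exports.

Local Open Scope classical_set_scope.
Local Open Scope ring_scope.

(** Write [Abar] for [A] stacked on [- B], [z y = x - sigma Abar^T y] and [S]
    for soft thresholding at level [sigma * lambda], which is the proximal map
    of the regularizer.  Minimizing the augmented Lagrangian over [w] gives, up
    to a constant,
    [theta y = |u|^2 / 2 + b.u - d.v + |S (z y)|^2 / (2 sigma)]
    (lemma [thetaE]), a convex function whose gradient is Lipschitz.

    Everything rests on [S] being piecewise linear: if [z'] is close to [z] and
    [Q] is any Clarke Jacobian of [S] at [z'], then [S z' - S z = Q (z' - z)]
    with no error term, and [|S|^2 / 2] has an equally exact quadratic model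
    ([softv_exact]).  Consequently, if [V] is the Newton matrix chosen by the
    algorithm at a point [y] close to [yhat], then
    [grad y = grad yhat + V (y - yhat)], and [theta y] is the corresponding
    quadratic polynomial in [y - yhat] ([theta_local_model]).

    Constraint nondegeneracy says that the columns of [B] that are active at
    [z yhat] span the space; active indices stay active nearby, where [Q] acts
    on them as the identity, so the matrices [V] are positive definite with a
    common constant ([newton_mx_coercive]).

    The limit point is stationary.  Both an exact solution and a
    conjugate gradient iterate [e] have a residual orthogonal to [e]
    ([cg_residual_orthogonal]), hence [grad.e = - e.(H e)], with [H] the
    regularized matrix of the linear system.  Near [yhat] this makes [e] a
    descent direction uniformly, the backtracking step length is bounded below,
    and a step decreases [theta] by a fixed multiple of [|grad|^2]
    ([ssn_step_decrease]).  As [theta] never increases along the sequence and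
    never falls below its value at the cluster point, the gradient vanishes
    there ([ssn_cluster_stationary]).

    Around a stationary [yhat] put [h = y - yhat].  The exactness of the model
    gives [H (h + e) = (H e + grad y) + eps (0, h_v)], and both terms on the
    right are of order [|h|^(1 + tau)]; coercivity of [H] turns this into
    [|h + e| <= K |h|^(1 + tau)].  The model also shows that the unit step
    passes the Armijo test because [mu < 1 / 2] ([ssn_local_step]).  So once an
    iterate enters a small ball it never moves away from [yhat] again; since
    [yhat] is a cluster point the whole sequence converges, at that rate. *)

(** * Euclidean geometry of column vectors *)

Section Euclidean.
Variable R : realType.

Lemma dotE k (x y : 'cV[R]_k) : dot x y = \sum_i x i 0 * y i 0.
Proof. by rewrite /dot mxE; apply: eq_bigr => i _; rewrite mxE. Qed.

Lemma dotC k (x y : 'cV[R]_k) : dot x y = dot y x.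
Proof. by rewrite !dotE; apply: eq_bigr => i _; rewrite mulrC. Qed.

Lemma dotDl k (x y z : 'cV[R]_k) : dot (x + y) z = dot x z + dot y z.
Proof. by rewrite /dot linearD mulmxDl mxE. Qed.

Lemma dotZl k a (x z : 'cV[R]_k) : dot (a *: x) z = a * dot x z.
Proof. by rewrite /dot linearZ /= -scalemxAl mxE. Qed.

Lemma dotDr k (x y z : 'cV[R]_k) : dot z (x + y) = dot z x + dot z y.
Proof. by rewrite !(dotC z) dotDl. Qed.

Lemma dotZr k a (x z : 'cV[R]_k) : dot z (a *: x) = a * dot z x.
Proof. by rewrite !(dotC z) dotZl. Qed.

Lemma dotNl k (x z : 'cV[R]_k) : dot (- x) z = - dot x z.
Proof. by rewrite -scaleN1r dotZl mulN1r. Qed.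

Lemma dotNr k (x z : 'cV[R]_k) : dot z (- x) = - dot z x.
Proof. by rewrite !(dotC z) dotNl. Qed.

Lemma dot0l k (z : 'cV[R]_k) : dot 0 z = 0.
Proof. by rewrite -(scale0r 0) dotZl mul0r. Qed.

Lemma dot0r k (z : 'cV[R]_k) : dot z 0 = 0.
Proof. by rewrite dotC dot0l. Qed.

Definition dot_linE := (dotDl, dotDr, dotNl, dotNr, dotZl, dotZr).

Lemma dot_mulmxl k l (M : 'M[R]_(k, l)) x y :
  dot (M *m x) y = dot x (M^T *m y).
Proof. by rewrite /dot trmx_mul mulmxA. Qed.

Lemma dot_mulmxr k l (M : 'M[R]_(k, l)) x y :
  dot y (M *m x) = dot (M^T *m y) x.
Proof. by rewrite dotC dot_mulmxl dotC. Qed.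

Lemma dot_ge0 k (x : 'cV[R]_k) : 0 <= dot x x.
Proof. by rewrite dotE sumr_ge0// => i _; rewrite -expr2 sqr_ge0. Qed.

Lemma dot_eq0 k (x : 'cV[R]_k) : (dot x x == 0) = (x == 0).
Proof.
apply/eqP/eqP => [|->]; last exact: dot0l.
rewrite dotE => /eqP; rewrite psumr_eq0; last first.
  by move=> i _; rewrite -expr2 sqr_ge0.
move=> /allP h; apply/colP => i; rewrite mxE; apply/eqP.
by have /implyP/(_ isT) := h i (mem_index_enum i); rewrite mulf_eq0 orbb.
Qed.

Lemma dot_split p q (x y : 'cV[R]_(p + q)) :
  dot x y = dot (usubmx x) (usubmx y) + dot (dsubmx x) (dsubmx y).
Proof.
by rewrite -[x in LHS]vsubmxK -[y in LHS]vsubmxK /dot tr_col_mx mul_row_col mxE.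
Qed.

Lemma enorm_ge0 k (x : 'cV[R]_k) : 0 <= enorm x.
Proof. exact: sqrtr_ge0. Qed.

Lemma enorm_sqr k (x : 'cV[R]_k) : enorm x ^+ 2 = dot x x.
Proof. by rewrite sqr_sqrtr// dot_ge0. Qed.

Lemma enorm_eq0 k (x : 'cV[R]_k) : (enorm x == 0) = (x == 0).
Proof. by rewrite -dot_eq0 -enorm_sqr sqrf_eq0. Qed.

Lemma enorm0 k : enorm (0 : 'cV[R]_k) = 0.
Proof. by apply/eqP; rewrite enorm_eq0. Qed.

Lemma enorm_le k (x : 'cV[R]_k) c : 0 <= c ->
  (enorm x <= c) = (dot x x <= c ^+ 2).
Proof. by move=> c0; rewrite -enorm_sqr ler_sqr// nnegrE enorm_ge0. Qed.

Lemma enormZ k a (x : 'cV[R]_k) : enorm (a *: x) = `|a| * enorm x.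
Proof. by rewrite /enorm !dot_linE mulrA -expr2 sqrtrM ?sqr_ge0// sqrtr_sqr. Qed.

Lemma enormN k (x : 'cV[R]_k) : enorm (- x) = enorm x.
Proof. by rewrite -scaleN1r enormZ normrN1 mul1r. Qed.

Lemma dot_le_enorm k (x y : 'cV[R]_k) : dot x y <= enorm x * enorm y.
Proof.
have [/eqP|x0] := eqVneq (enorm x) 0.
  by rewrite enorm_eq0 => /eqP ->; rewrite dot0l enorm0 mul0r.
have [/eqP|y0] := eqVneq (enorm y) 0.
  by rewrite enorm_eq0 => /eqP ->; rewrite dot0r enorm0 mulr0.
have xp : 0 < enorm x by rewrite lt_neqAle eq_sym x0 enorm_ge0.
have yp : 0 < enorm y by rewrite lt_neqAle eq_sym y0 enorm_ge0.
(* the square of the distance between the two vectors after rescaling them to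
   the common length [enorm x * enorm y] *)
have := dot_ge0 (enorm y *: x - enorm x *: y).
rewrite !dot_linE -!enorm_sqr (dotC y x) => h.
rewrite -subr_ge0 -(pmulr_rge0 _ (mulr_gt0 xp yp)).
by move: h; set a := enorm x; set b := enorm y; lra.
Qed.

Lemma dot_ge_enorm k (x y : 'cV[R]_k) : - (enorm x * enorm y) <= dot x y.
Proof. by rewrite lerNl -dotNl -(enormN x) dot_le_enorm. Qed.

Lemma enormD k (x y : 'cV[R]_k) : enorm (x + y) <= enorm x + enorm y.
Proof.
rewrite enorm_le ?addr_ge0 ?enorm_ge0// !dot_linE -!enorm_sqr (dotC y x).
by have := dot_le_enorm x y; lra.
Qed.

Lemma normr_coord_le_enorm k (x : 'cV[R]_k) i : `|x i 0| <= enorm x.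
Proof.
rewrite -(@ler_pXn2r _ 2) ?nnegrE ?enorm_ge0// enorm_sqr dotE.
rewrite real_normK ?num_real//.
by rewrite (bigD1 i)//= -expr2 lerDl sumr_ge0// => j _; rewrite -expr2 sqr_ge0.
Qed.

Lemma mulmx_bounded k l (M : 'M[R]_(k, l)) :
  exists2 C, 0 <= C & forall x, enorm (M *m x) <= C * enorm x.
Proof.
pose r i := (row i M)^T.
exists (Num.sqrt (\sum_i dot (r i) (r i))) => [|x]; first exact: sqrtr_ge0.
rewrite enorm_le ?mulr_ge0 ?sqrtr_ge0 ?enorm_ge0// exprMn sqr_sqrtr; last first.
  by rewrite sumr_ge0// => i _; exact: dot_ge0.
rewrite dotE mulr_suml; apply: ler_sum => i _.
have -> : (M *m x) i 0 = dot (r i) x.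
  by rewrite /dot /r trmxK -row_mul [in RHS]mxE.
rewrite -expr2 -enorm_sqr -exprMn -[leLHS]real_normK ?num_real//.
rewrite ler_sqr ?nnegrE ?mulr_ge0 ?enorm_ge0// ler_norml.
by rewrite dot_ge_enorm dot_le_enorm.
Qed.

Lemma normr_le_enorm k (x : 'cV[R]_k) : `|x| <= enorm x.
Proof.
rewrite [leLHS]/Num.norm /= mx_normrE; apply: bigmax_le => [|[i j] _ /=].
  exact: enorm_ge0.
by rewrite ord1; exact: normr_coord_le_enorm.
Qed.

Lemma enorm_le_normr k (x : 'cV[R]_k) : enorm x <= Num.sqrt k%:R * `|x|.
Proof.
rewrite enorm_le ?mulr_ge0 ?sqrtr_ge0// exprMn sqr_sqrtr// dotE.
rewrite mulr_natl -[k in _ *+ k]card_ord -sumr_const; apply: ler_sum => i _.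
rewrite -expr2 -[leLHS]real_normK ?num_real// ler_sqr ?nnegrE//.
rewrite [leRHS]/Num.norm /= mx_normrE.
exact: (le_bigmax _ (fun ij : 'I_k * 'I_1 => `|x ij.1 ij.2|) (i, 0)).
Qed.

End Euclidean.
(** * Scalar soft thresholding *)

Section SoftThreshold.
Variables (R : realType) (k : R).
Hypothesis k_gt0 : 0 < k.

Definition soft (z : R) : R :=
  if k < z then z - k else if z < - k then z + k else 0.

(** The Clarke derivatives of [soft] at [z]: determined off the kinks, anything
    between the two one-sided derivatives at a kink. *)
Definition soft_slope (z q : R) : Prop :=
  [/\ 0 <= q <= 1, k < `|z| -> q = 1 & `|z| < k -> q = 0].

Lemma soft_gt z : k < z -> soft z = z - k.
Proof. by rewrite /soft => ->. Qed.

Lemma soft_lt z : z < - k -> soft z = z + k.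
Proof.
by have k0 := k_gt0; rewrite /soft => zk; rewrite ltNge ifF ?zk//; apply/negbF; lra.
Qed.

Lemma soft_eq0 z : `|z| <= k -> soft z = 0.
Proof.
by rewrite /soft ler_norml => /andP[? ?]; rewrite !ltNge !ifF//; apply/negbF.
Qed.

(** Together with [soft_residualM], the optimality condition of the proximal
    problem: [z - soft z] is a subgradient of [k * `|.|] at [soft z].  The
    variational inequalities below only use this. *)
Lemma soft_residual z : `|z - soft z| <= k.
Proof.
rewrite ler_norml /soft; have k0 := k_gt0.
by case: ltP => ?; [|case: ltP => ?]; apply/andP; split; lra.
Qed.

Lemma soft_residualM z : (z - soft z) * soft z = k * `|soft z|.
Proof.
rewrite /soft; have k0 := k_gt0; case: ltP => ?; [|case: ltP => ?].
- by rewrite gtr0_norm; lra.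
- by rewrite ltr0_norm; lra.
- by rewrite normr0 !mulr0.
Qed.

Lemma soft_residual_max z t : (z - soft z) * t <= k * `|t|.
Proof.
by rewrite (le_trans (ler_norm _))// normrM ler_wpM2r// soft_residual.
Qed.

Lemma soft_prox z t :
  k * `|soft z| + 2^-1 * (soft z - z) ^+ 2 + 2^-1 * (t - soft z) ^+ 2
    <= k * `|t| + 2^-1 * (t - z) ^+ 2.
Proof. by have := soft_residual_max z t; rewrite -soft_residualM; lra. Qed.

(** [2^-1 * soft ^+ 2] is the Moreau envelope of the conjugate penalty; like
    every Moreau envelope it is convex and its derivative, [soft], is
    1-Lipschitz. *)
Lemma soft_sqr_expansion z h :
  0 <= 2^-1 * soft (z + h) ^+ 2 - 2^-1 * soft z ^+ 2 - soft z * h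
    <= 2^-1 * h ^+ 2.
Proof.
set z' := z + h; have -> : h = z' - z by rewrite /z' addrC addKr.
have := soft_residual_max z (soft z'); have := soft_residual_max z' (soft z).
rewrite -!soft_residualM => ? ?.
have := sqr_ge0 (soft z' - soft z).
have := sqr_ge0 ((z' - soft z') - (z - soft z)).
by move=> ? ?; apply/andP; split; lra.
Qed.

(** First-order expansions of [soft] around [z] hold without error when the
    slope is taken at the nearby point [z'] rather than at [z]: off the kinks
    [soft] is affine near [z], while at a kink [soft z = 0] and [z'] selects
    the affine piece that contains both points. *)
Lemma soft_exact z : exists2 rho, 0 < rho &
  forall z' q, `|z' - z| < rho -> soft_slope z' q ->
  [/\ soft z' - soft z = q * (z' - z),
      2^-1 * soft z' ^+ 2 - 2^-1 * soft z ^+ 2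
        = soft z * (z' - z) + 2^-1 * (q * (z' - z) ^+ 2),
      k < `|z| -> q = 1 & `|z| < k -> q = 0].
Proof.
have k0 := k_gt0; case: (ltgtP `|z| k) => zk.
- exists (k - `|z|); first by rewrite subr_gt0.
  move=> z' q zz [_ _ q0].
  have z'k : `|z'| < k.
    by rewrite -[z'](subrK z) (le_lt_trans (ler_normD _ _))//; lra.
  by rewrite q0// !soft_eq0 ?ltW//; split=> //; lra.
- exists (`|z| - k); first by rewrite subr_gt0.
  move=> z' q zz [_ q1 _].
  have z'k : k < `|z'|.
    have : `|z| <= `|z' - z| + `|z'|.
      by rewrite distrC -{1}[z](subrK z') ler_normD.
    lra.
  rewrite q1//; move: zz; rewrite ltr_norml; case: (ger0P z) zk => z0 zk.
    move=> /andP[? ?]; rewrite gtr0_norm in z'k; last by lra.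
    by rewrite !soft_gt//; split=> //; lra.
  move=> /andP[? ?]; rewrite ltr0_norm in z'k; last by lra.
  have ? : z < - k by lra.
  have ? : z' < - k by lra.
  by rewrite !soft_lt//; split=> //; lra.
- exists k => // z' q; rewrite ltr_norml => /andP[? ?] [_ q1 q0].
  have s0 : soft z = 0 by rewrite soft_eq0// zk.
  (* either [z' = z], or [z'] is not a kink and [q] is [0] or [1] *)
  suff s1 : soft z' = q * (z' - z) /\
      q * (z' - z) * (q * (z' - z)) = q * (z' - z) ^+ 2.
    by rewrite s0; case: s1 => -> s1; split; rewrite ?zk ?ltxx//; lra.
  case: (ltgtP `|z'| k) => z'k.
  + by rewrite q0// soft_eq0 ?ltW//; lra.
  + rewrite q1//; case: (ger0P z') z'k => z'0 z'k.
      by rewrite soft_gt//; case: (ger0P z) zk => ? ?; lra.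
    rewrite soft_lt; last by lra.
    by case: (ger0P z) zk => ? ?; lra.
  + have -> : z' = z.
      by case: (ger0P z') z'k => ? ?; case: (ger0P z) zk => ? ?; lra.
    by rewrite s0; lra.
Qed.

End SoftThreshold.
(** * Coordinatewise soft thresholding *)

Section VectorSoftThreshold.
Variables (R : realType) (n : nat) (k : R).
Hypothesis k_gt0 : 0 < k.
Implicit Types (z t : 'cV[R]_n) (Q : 'M[R]_n).

Definition softv z : 'cV[R]_n := \col_i soft k (z i 0).

(** Contains the Clarke Jacobian of [softv] at [z]; see [clarke_soft]. *)
Definition soft_jacobian z Q : Prop :=
  (forall i j, i != j -> Q i j = 0) /\
  (forall i, soft_slope k (z i 0) (Q i i)).

Lemma soft_jacobian_mulmx z Q t i :
  soft_jacobian z Q -> (Q *m t) i 0 = Q i i * t i 0.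
Proof.
move=> [Q0 _]; rewrite mxE (bigD1 i)//= big1 ?addr0// => j ji.
by rewrite Q0 ?mul0r// eq_sym.
Qed.

Lemma dot_soft_jacobian z Q t : soft_jacobian z Q ->
  dot t (Q *m t) = \sum_i Q i i * t i 0 ^+ 2.
Proof.
move=> Qz; rewrite dotE; apply: eq_bigr => i _.
by rewrite (soft_jacobian_mulmx _ _ Qz) mulrCA expr2.
Qed.

Lemma soft_jacobian_nonexpansive z Q t : soft_jacobian z Q ->
  enorm (Q *m t) <= enorm t.
Proof.
move=> Qz; rewrite enorm_le ?enorm_ge0// enorm_sqr !dotE; apply: ler_sum => i _.
rewrite (soft_jacobian_mulmx _ _ Qz); have [_ /(_ i) [/andP[q0 q1] _ _]] := Qz.
rewrite mulrACA -!expr2 ler_piMl ?sqr_ge0// expr_le1//.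
Qed.

Lemma soft_jacobian_dot_ge0 z Q t : soft_jacobian z Q -> 0 <= dot t (Q *m t).
Proof.
move=> Qz; rewrite (dot_soft_jacobian _ Qz) sumr_ge0// => i _.
by have [_ /(_ i) [/andP[q0 q1] _ _]] := Qz; rewrite mulr_ge0 ?sqr_ge0.
Qed.

(** The objective is separable, and in each coordinate it exceeds its value at
    [soft] by half the squared distance; so the minimizer is unique and [get]
    has to return it. *)
Lemma prox_l1norm z : prox (fun t => k * l1norm t) z = softv z.
Proof.
pose f t := k * l1norm t + 2^-1 * enorm (t - z) ^+ 2.
have fE t : f t = \sum_i (k * `|t i 0| + 2^-1 * (t i 0 - z i 0) ^+ 2).
  rewrite /f enorm_sqr dotE big_split /= -!mulr_sumr; congr (_ + _ * _).
  by apply: eq_bigr => i _; rewrite !mxE expr2.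
have soft_min t : f (softv z) + 2^-1 * dot (t - softv z) (t - softv z) <= f t.
  rewrite !fE dotE mulr_sumr -big_split /=; apply: ler_sum => i _.
  by rewrite !mxE -expr2 soft_prox.
rewrite /prox; set M := [set t | _].
have Msoft : M (softv z).
  by move=> t; apply: le_trans (soft_min t); rewrite lerDl mulr_ge0 ?dot_ge0 ?invr_ge0.
have Mget : M (get M) by apply: getPex; exists (softv z).
apply/eqP; rewrite -subr_eq0 -dot_eq0 eq_le dot_ge0 andbT.
have := soft_min (get M); have := Mget (softv z); rewrite -/(f _) -/(f _).
by lra.
Qed.

Lemma ord_common_radius (P : 'I_n -> R -> Prop) :
  (forall i, exists2 r, 0 < r & forall e, e < r -> P i e) ->
  exists2 r, 0 < r & forall e, e < r -> forall i, P i e.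
Proof.
move=> h; pose r i := sval (cid2 (h i)).
exists (\big[Num.min/1]_i r i) => [|e er i].
  by apply: lt_bigmin => // i _; rewrite /r; case: cid2.
have : e < r i by rewrite (lt_le_trans er)// bigmin_le_cond.
by rewrite /r; case: cid2 => //= ri _; apply.
Qed.

Lemma softv_exact z : exists2 rho, 0 < rho & forall z' Q,
  enorm (z' - z) < rho -> soft_jacobian z' Q ->
  [/\ softv z' - softv z = Q *m (z' - z),
      2^-1 * dot (softv z') (softv z') - 2^-1 * dot (softv z) (softv z)
        = dot (softv z) (z' - z) + 2^-1 * dot (z' - z) (Q *m (z' - z))
    & forall i, k < `|z i 0| -> Q i i = 1].
Proof.
pose P i (e : R) := forall z' q : R, `|z' - z i 0| <= e -> soft_slope k z' q ->
  [/\ soft k z' - soft k (z i 0) = q * (z' - z i 0),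
      2^-1 * soft k z' ^+ 2 - 2^-1 * soft k (z i 0) ^+ 2
        = soft k (z i 0) * (z' - z i 0) + 2^-1 * (q * (z' - z i 0) ^+ 2)
    & k < `|z i 0| -> q = 1].
have [|rho rho0 hrho] := @ord_common_radius P.
  move=> i; have [r r0 hr] := soft_exact k_gt0 (z i 0).
  by exists r => // e er z' q /le_lt_trans/(_ er) zz' /(hr z' q zz') [? ? ? _].
exists rho => // z' Q zz' Qz'.
have H i := hrho _ zz' i (z' i 0) (Q i i).
have {}H i : [/\ soft k (z' i 0) - soft k (z i 0) = Q i i * (z' i 0 - z i 0),
      2^-1 * soft k (z' i 0) ^+ 2 - 2^-1 * soft k (z i 0) ^+ 2
        = soft k (z i 0) * (z' i 0 - z i 0)
          + 2^-1 * (Q i i * (z' i 0 - z i 0) ^+ 2)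
    & k < `|z i 0| -> Q i i = 1].
  apply: H; last exact: Qz'.2.
  by have := normr_coord_le_enorm (z' - z) i; rewrite !mxE.
split=> [|| i]; last by case: (H i).
- apply/colP => i; rewrite (soft_jacobian_mulmx _ _ Qz') !mxE.
  by case: (H i).
- rewrite (dot_soft_jacobian _ Qz') !dotE !mulr_sumr -sumrB -big_split /=.
  by apply: eq_bigr => i _; rewrite !mxE -!expr2; case: (H i).
Qed.

End VectorSoftThreshold.
(** * The reduced dual function and its gradient *)

Section ReducedDual.
Variables (R : realType) (m n s : nat).
Variables (A : 'M[R]_(m, n)) (b : 'cV[R]_m) (B : 'M[R]_(s, n)) (d : 'cV[R]_s).
Variables (lambda sigma : R) (x : 'cV[R]_n).
Hypotheses (lambda_gt0 : 0 < lambda) (sigma_gt0 : 0 < sigma).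

Notation k := (sigma * lambda).
Notation zarg := (prox_arg A B sigma x).
Notation theta := (theta A b B d lambda sigma x).
Notation Abar := (Abar A B).
Implicit Types (y h : 'cV[R]_(m + s)) (w t z : 'cV[R]_n).

Lemma threshold_gt0 : 0 < k.
Proof. exact: mulr_gt0. Qed.

Lemma tr_Abar_mul y : Abar^T *m y = A^T *m usubmx y - B^T *m dsubmx y.
Proof.
by rewrite -{1}(vsubmxK y) /Defs.Abar tr_col_mx mul_row_col linearN mulNmx.
Qed.

Lemma prox_argD y h : zarg (y + h) = zarg y - sigma *: (Abar^T *m h).
Proof. by rewrite /prox_arg mulmxDr scalerDr opprD addrA. Qed.

Lemma lasso_proxE z : lasso_prox lambda sigma z = softv k z.
Proof.
rewrite -(prox_l1norm threshold_gt0) /lasso_prox; congr (prox _ z).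
by apply/funext => t; rewrite /lasso_reg mulrA.
Qed.

Lemma softv_residual_dot z :
  dot (z - softv k z) (softv k z) = k * l1norm (softv k z).
Proof.
rewrite dotE /l1norm mulr_sumr; apply: eq_bigr => i _; rewrite !mxE.
exact: soft_residualM threshold_gt0 _.
Qed.

Lemma softv_residual_max z t : dot (z - softv k z) t <= k * l1norm t.
Proof.
rewrite dotE /l1norm mulr_sumr; apply: ler_sum => i _; rewrite !mxE.
exact: soft_residual_max threshold_gt0 _ _.
Qed.

Lemma lasso_conjugate_ge w t :
  ((dot w t - lambda * l1norm t)%:E <= conjugate (lasso_reg lambda) w)%E.
Proof. by apply: ereal_sup_ubound; exists t. Qed.

(** [sigma^-1 *: (z - softv k z)] has sup norm at most [lambda], and the
    conjugate of [lambda * l1norm] vanishes on that ball. *)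
Lemma lasso_conjugate_residual z :
  conjugate (lasso_reg lambda) (sigma^-1 *: (z - softv k z)) = 0%E.
Proof.
apply/eqP; rewrite eq_le; apply/andP; split.
  apply: ge_ereal_sup => _ [t _ <-]; rewrite lee_fin subr_le0 /lasso_reg dotZl.
  by rewrite mulrC ler_pdivrMr// mulrAC -(mulrC sigma) softv_residual_max.
apply: le_trans (lasso_conjugate_ge _ 0); rewrite lee_fin dot0r /l1norm.
by rewrite big1 ?mulr0 ?subr0// => i _; rewrite mxE normr0.
Qed.

(** By the Fenchel-Young inequality at [t], the left-hand side bounds the
    [w]-dependent part of the augmented Lagrangian from below.  Completing the
    square exhibits its minimum, attained at [w = sigma^-1 *: (z - t)], where
    that inequality is an equality. *)
Lemma auglag_complete_square y w :
  let z := zarg y in let t := softv k z in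
  let r := A^T *m usubmx y - B^T *m dsubmx y + w in
  dot w t - lambda * l1norm t - dot x r + sigma / 2 * enorm r ^+ 2
  = (2 * sigma)^-1 * (dot t t - dot x x)
    + (2 * sigma)^-1 * enorm (sigma *: w - (z - t)) ^+ 2.
Proof.
move=> z t r; set om := sigma *: w - (z - t).
have s0 : sigma != 0 by rewrite gt_eqF.
have -> : lambda * l1norm t = sigma^-1 * dot (z - t) t.
  by rewrite softv_residual_dot !mulrA mulVf// mul1r.
have -> : r = sigma^-1 *: (x + om - t).
  apply: (scalerI s0); rewrite scalerA mulfV// scale1r /om /z /r -tr_Abar_mul.
  rewrite /prox_arg scalerDr; move: (sigma *: _) (sigma *: _) => p q.
  by apply/colP => i; rewrite !mxE; ring.
have -> : w = sigma^-1 *: (om + (z - t)) by rewrite subrK scalerA mulVf// scale1r.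
clearbody om t z; rewrite !enorm_sqr !dot_linE (dotC om x) (dotC t x) (dotC t om).
by field.
Qed.

Lemma thetaE y : theta y = hstar b (usubmx y) - dot (dsubmx y) d
  + (2 * sigma)^-1 * (dot (softv k (zarg y)) (softv k (zarg y)) - dot x x).
Proof.
set v := RHS; suff inf_eq : ereal_inf
    [set auglag A b B d lambda sigma x (usubmx y) (dsubmx y) w | w in setT] = v%:E.
  by rewrite /Defs.theta inf_eq.
apply/eqP; rewrite eq_le; apply/andP; split.
  apply: ereal_inf_lbound; set z := zarg y.
  exists (sigma^-1 *: (z - softv k z)) => //.
  rewrite /auglag lasso_conjugate_residual adde0 -EFinN -!EFinD; congr (_%:E).
  set w := sigma^-1 *: _; have := auglag_complete_square y w => /=.
  rewrite -/z /w scalerA mulfV ?gt_eqF// scale1r subrr enorm0 expr0n mulr0 addr0.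
  rewrite dotZl softv_residual_dot -!mulrA mulKf ?gt_eqF// subrr add0r -/w => h.
  by rewrite -addrA h /v.
apply: le_ereal_inf_tmp => _ [w _ <-]; rewrite /auglag.
have := auglag_complete_square y w => /=.
have := lasso_conjugate_ge w (softv k (zarg y)).
set r := _ + w; set c := conjugate _ _; case: c => [c| |] //; last first.
  by move=> _ _; exact: leey.
rewrite -!EFinD !lee_fin => hc hr.
have : 0 <= (2 * sigma)^-1 * enorm (sigma *: w - (zarg y - softv k (zarg y))) ^+ 2.
  by rewrite mulr_ge0 ?sqr_ge0// invr_ge0 mulr_ge0 ?ltW.
by rewrite /v; lra.
Qed.


Definition theta_grad y : 'cV[R]_(m + s) :=
  col_mx (usubmx y + b) (- d) - Abar *m softv k (zarg y).

(** Bounds the remainder at every point in both directions: the lower bound is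
    convexity, the upper one the descent lemma for a Lipschitz gradient. *)
Lemma theta_expansion y h :
  0 <= theta (y + h) - theta y - dot (theta_grad y) h
    <= 2^-1 * dot (usubmx h) (usubmx h)
       + sigma / 2 * dot (Abar^T *m h) (Abar^T *m h).
Proof.
pose z := zarg y; pose p := - sigma *: (Abar^T *m h).
pose D := \sum_i (2^-1 * soft k (z i 0 + p i 0) ^+ 2 - 2^-1 * soft k (z i 0) ^+ 2
                  - soft k (z i 0) * p i 0).
have s0 : sigma != 0 by rewrite gt_eqF.
have -> : theta (y + h) - theta y - dot (theta_grad y) h
    = 2^-1 * dot (usubmx h) (usubmx h) + sigma^-1 * D.
  have -> : D = 2^-1 * dot (softv k (z + p)) (softv k (z + p))
      - 2^-1 * dot (softv k z) (softv k z) - dot (softv k z) p.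
    rewrite /D !sumrB !dotE !mulr_sumr; congr (_ - _ - _);
    by apply: eq_bigr => i _; rewrite !mxE ?expr2.
  rewrite !thetaE prox_argD -scaleNr -/p -/z /theta_grad /hstar -/z !enorm_sqr.
  rewrite (dot_split _ h) !linearD /= col_mxKu col_mxKd !linearN /=.
  have -> : dot (softv k z) p = - sigma * (dot (usubmx (Abar *m softv k z)) (usubmx h)
      + dot (dsubmx (Abar *m softv k z)) (dsubmx h)).
    by rewrite -dot_split dot_mulmxl dotZr.
  rewrite !dot_linE (dotC (usubmx h) (usubmx y)) (dotC d) ?(dotC b).
  by rewrite ?(dotC d); field.
have hD i : 0 <= 2^-1 * soft k (z i 0 + p i 0) ^+ 2 - 2^-1 * soft k (z i 0) ^+ 2
                  - soft k (z i 0) * p i 0 <= 2^-1 * p i 0 ^+ 2.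
  exact: soft_sqr_expansion threshold_gt0 _ _.
have D0 : 0 <= D by rewrite sumr_ge0// => i _; case/andP: (hD i).
have sD0 : 0 <= sigma^-1 * D by rewrite mulr_ge0// invr_ge0 ltW.
have u0 : 0 <= 2^-1 * dot (usubmx h) (usubmx h) by rewrite mulr_ge0 ?dot_ge0// invr_ge0.
apply/andP; split; first exact: addr_ge0.
rewrite lerD2l.
rewrite mulrC ler_pdivrMr//.
have -> : sigma / 2 * dot (Abar^T *m h) (Abar^T *m h) * sigma = 2^-1 * dot p p.
  by rewrite /p !dot_linE; ring.
by rewrite dotE mulr_sumr; apply: ler_sum => i _; rewrite -expr2; case/andP: (hD i).
Qed.

End ReducedDual.
(** * Directional derivatives and Clarke Jacobians *)

Section FirstOrder.
Variable R : realType.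

Lemma derive_quadratic_error p (f : 'cV[R]_p -> R^o) (y g v : 'cV[R]_p) (C : R) :
  (forall h, `|f (y + h) - f y - dot g h| <= C * dot h h) ->
  'D_v f y = dot g v.
Proof.
move=> hf; rewrite /derive; apply: cvg_lim => //.
apply/cvgrPdist_le => e e0; near=> t.
have t0 : t != 0 by near: t; exact: nbhs_dnbhs_neq.
have tC : `|t| * (`|C| * dot v v + 1) <= e.
  rewrite -ler_pdivlMr; last by rewrite ltr_wpDl// mulr_ge0 ?dot_ge0.
  near: t; apply: dnbhs0_le; rewrite divr_gt0// ltr_wpDl// mulr_ge0 ?dot_ge0//.
have -> : dot g v - t^-1 *: ((f \o shift y) (t *: v) - f y)
    = - (t^-1 * (f (y + t *: v) - f y - dot g (t *: v))).
  rewrite /= dotZr [t *: v + y]addrC /GRing.scale /=.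
  by field.
rewrite normrN normrM normfV ler_pdivrMl ?normr_gt0//.
apply: le_trans (hf _) _; rewrite !dot_linE.
have -> : t * (t * dot v v) = `|t| * `|t| * dot v v
  by rewrite -normrM ger0_norm ?mulrA// -expr2 sqr_ge0.
apply: (@le_trans _ _ (`|t| * (`|t| * (`|C| * dot v v + 1)))).
  rewrite -!mulrA mulrCA ler_wpM2l// mulrCA ler_wpM2l//.
  by rewrite ler_wpDr// ler_wpM2r ?dot_ge0// ler_norm.
by rewrite ler_wpM2l.
Unshelve. all: by end_near. Qed.

End FirstOrder.

Section ClarkeSlopes.
Variables (R : realType) (n : nat) (k : R).
Hypothesis k_gt0 : 0 < k.

(** Outer semicontinuity of the Clarke derivative of [soft]. *)
Lemma soft_slope_near (z : R) : exists2 rho, 0 < rho &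
  forall z' q : R, `|z' - z| < rho -> soft_slope k z' q -> soft_slope k z q.
Proof.
have [r r0 hr] := soft_exact k_gt0 z; exists r => // z' q zz sq.
by have [q01 _ _] := sq; have [_ _ ? ?] := hr _ _ zz sq; split.
Qed.

Lemma soft_slope_exists (z : R) : exists q, soft_slope k z q.
Proof.
exists (if k < `|z| then 1 else 0).
split; first by case: ltP; rewrite lexx ler01.
  by move=> ->.
by move=> zk; rewrite ltNge ltW.
Qed.

(** By [soft_exact] a difference quotient of [soft] is itself a slope at the
    nearby point, hence at [z].  This puts every directional derivative among
    the slopes, so that the points where [softv] fails to be differentiable
    never have to be determined. *)
Lemma soft_quotient_slope (z : R) :
  \forall t \near (0 : R)^', soft_slope k z (t^-1 * (soft k (t + z) - soft k z)).
Proof.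
have [r r0 hr] := soft_exact k_gt0 z.
have [r' r'0 hr'] := soft_slope_near z.
near=> t.
have t0 : t != 0 by near: t; exact: nbhs_dnbhs_neq.
have tE : (t + z) - z = t by rewrite addrK.
have [q sq] := soft_slope_exists (t + z).
have [|-> _ _ _] := hr (t + z) q _ sq.
  by rewrite tE; near: t; exact: dnbhs0_lt.
rewrite tE mulrCA mulVf// mulr1; apply: hr' sq.
by rewrite tE; near: t; exact: dnbhs0_lt.
Unshelve. all: by end_near. Qed.

Lemma soft_slope_closed (z : R) : closed [set q : R | soft_slope k z q].
Proof.
have -> : [set q : R | soft_slope k z q] = [set q | q >= 0] `&` [set q | q <= 1]
   `&` (if k < `|z| then [set 1] else setT)
   `&` (if `|z| < k then [set 0] else setT).
  apply/seteqP; split=> q /=.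
    by move=> [/andP[q0 q1] h h']; do! split => //; case: ifP => //; auto.
  move=> [[[q0 q1] h] h']; split; first by rewrite q0.
    by move=> zk; move: h; rewrite zk.
  by move=> zk; move: h'; rewrite zk.
apply: closedI; [apply: closedI; [apply: closedI|]|].
- exact: closed_ge.
- exact: closed_le.
- by case: ifP => _; [exact: closed_eq | exact: closedT].
- by case: ifP => _; [exact: closed_eq | exact: closedT].
Qed.

Lemma soft_slope_convex (z : R) N (c q : 'I_N -> R) :
  (forall i, 0 <= c i) -> \sum_i c i = 1 ->
  (forall i, soft_slope k z (q i)) -> soft_slope k z (\sum_i c i * q i).
Proof.
move=> c0 c1 sq; split.
- apply/andP; split.
    by apply: sumr_ge0 => i _; have [/andP[? ?] _ _] := sq i; exact: mulr_ge0.
  by rewrite -c1; apply: ler_sum => i _; have [/andP[? ?] _ _] := sq i; exact: ler_piMr.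
- by move=> zk; rewrite -[RHS]c1; apply: eq_bigr => i _; have [_ -> //] := sq i; rewrite mulr1.
- by move=> zk; rewrite big1// => i _; have [_ _ -> //] := sq i; rewrite mulr0.
Qed.

Lemma cjacobian_soft (z : 'cV[R]_n) : differentiable (@softv R n k) z ->
  soft_jacobian k z (cjacobian (@softv R n k) z).
Proof.
move=> dz.
have lim_coord i j : 
    (fun t : R => t^-1 * (soft k (t * (i == j)%:R + z i 0) - soft k (z i 0)))
     @ 0^' --> (cjacobian (@softv R n k) z) i j.
  rewrite mxE; set v := delta_mx j 0.
  have := @diff_derivable _ _ _ _ _ v dz.
  rewrite /derivable => /(cvg_comp _ _)/(_ (@coord_continuous _ _ _ i 0 _)) h.
  apply: cvg_trans h; apply: near_eq_cvg; near=> t.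
  by rewrite /= !mxE eqxx andbT.
split=> [i j ij|i].
  apply: (cvg_unique _ (lim_coord i j)) => //.
  apply: cvg_near_cst; near=> t.
  by rewrite (negbTE ij) mulr0n mulr0 add0r subrr mulr0.
refine (closed_cvg (soft_slope k (z i 0)) (@soft_slope_closed (z i 0)) _ _
  (lim_coord i i)).
near=> t; rewrite /= eqxx mulr1; near: t; exact: soft_quotient_slope.
Unshelve. all: by end_near. Qed.

Lemma bsubdiff_soft (z : 'cV[R]_n) Q :
  bsubdiff (@softv R n k) z Q -> soft_jacobian k z Q.
Proof.
move=> [zs [dzs zs_z] J_Q].
have J_Qij i j : (fun l => cjacobian (@softv R n k) (zs l) i j) @ \oo --> Q i j.
  exact: cvg_comp J_Q (@coord_continuous _ _ _ i j _).
have sJ l := cjacobian_soft (dzs l).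
split=> [i j ij|i].
  apply: (cvg_unique _ (J_Qij i j)) => //.
  by apply: cvg_near_cst; near=> l; rewrite (sJ l).1.
refine (closed_cvg (soft_slope k (z i 0)) (@soft_slope_closed (z i 0)) _ _
  (J_Qij i i)).
have [r r0 hr] := soft_slope_near (z i 0).
have zsi : (fun l => zs l i 0) @ \oo --> z i 0.
  exact: cvg_comp zs_z (@coord_continuous _ _ _ i 0 _).
near=> l; apply: hr ((sJ l).2 i).
by rewrite distrC; near: l; move/cvgrPdist_lt: zsi; exact.
Unshelve. all: by end_near. Qed.

Lemma clarke_soft (z : 'cV[R]_n) Q :
  clarke (@softv R n k) z Q -> soft_jacobian k z Q.
Proof.
move=> [N [c [M [c0 c1 hM ->]]]].
have hJ i := bsubdiff_soft (hM i); split=> [i j ij|i].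
  by rewrite summxE big1// => l _; rewrite mxE (hJ l).1// mulr0.
rewrite summxE; under eq_bigr do rewrite mxE.
by apply: soft_slope_convex => // l; exact: (hJ l).2.
Qed.

End ClarkeSlopes.
(** * Residuals of the conjugate gradient method *)

Section ConjugateGradient.
Variables (R : realType) (k : nat) (H : 'M[R]_k) (g : 'cV[R]_k).
Hypothesis H_sym : H^T = H.
Hypothesis H_pd : forall e, e != 0 -> 0 < dot e (H *m e).

Let st i := iter i (cg_step H) (0, g, g).
Let sol i := (st i).1.1.
Let res i := (st i).1.2.
Let dir i := (st i).2.
Let alpha i := dot (res i) (res i) / dot (dir i) (H *m dir i).
Let beta i := dot (res i.+1) (res i.+1) / dot (res i) (res i).

Lemma cg_rec i : [/\ sol i.+1 = sol i + alpha i *: dir i,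
    res i.+1 = res i - alpha i *: (H *m dir i)
  & dir i.+1 = res i.+1 + beta i *: dir i].
Proof.
rewrite /beta /alpha /dir /res /sol /st iterS.
by case: (iter i _ _) => [[e r] p].
Qed.

Lemma cg_res_sol i : res i = g - H *m sol i.
Proof.
elim: i => [|i IH]; first by rewrite /res /sol /= mulmx0 subr0.
have [-> -> _] := cg_rec i.
by rewrite IH mulmxDr -scalemxAr opprD addrA.
Qed.

Lemma cg_dir_eq0 i : res i = 0 -> dir i = 0.
Proof.
case: i => [//|i] ri; have [_ _ ->] := cg_rec i.
by rewrite /beta ri dot0l mul0r scale0r addr0.
Qed.

(** Division-free forms of the two step sizes, valid also after termination,
    when the residual, the direction and both quotients are zero. *)
Lemma cg_alphaE i : dot (res i) (dir i) = dot (res i) (res i) ->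
  alpha i * dot (dir i) (H *m dir i) = dot (res i) (res i).
Proof.
move=> rp; have [p0|p0] := eqVneq (dir i) 0.
  by rewrite -rp p0 dot0l dot0r mulr0.
by rewrite /alpha mulfVK// gt_eqF// H_pd.
Qed.

Lemma cg_betaE i : beta i * dot (res i) (res i) = dot (res i.+1) (res i.+1).
Proof.
have [r0|r0] := eqVneq (res i) 0; last by rewrite /beta mulfVK// dot_eq0.
have [_ -> _] := cg_rec i.
by rewrite /alpha r0 dot0l mul0r mulr0 scale0r subr0 dot0l.
Qed.

(** The classical three invariants, proved together: residuals are orthogonal
    to earlier directions and directions are mutually conjugate. *)
Lemma cg_orthogonality i :
  [/\ dot (res i) (dir i) = dot (res i) (res i),
      forall j, (j < i)%N -> dot (res i) (dir j) = 0
    & forall j, (j < i)%N -> dot (dir i) (H *m dir j) = 0].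
Proof.
elim/ltn_ind: i => -[//|i] IH; have [rp r_p p_Hp] := IH i (ltnSn i).
have [_ rS pS] := cg_rec i.
have r_pS j : (j < i.+1)%N -> dot (res i.+1) (dir j) = 0.
  rewrite ltnS leq_eqVlt rS !dot_linE dot_mulmxl H_sym => /orP[/eqP ->|ji].
    by rewrite rp cg_alphaE// subrr.
  by rewrite r_p// p_Hp// mulr0 subr0.
have r_r j : (j < i.+1)%N -> dot (res i.+1) (res j) = 0.
  case: j => [|j] ji; first exact: (r_pS 0%N ji).
  have [_ _ pj] := cg_rec j.
  have -> : res j.+1 = dir j.+1 - beta j *: dir j by rewrite pj addrK.
  by rewrite !dot_linE !r_pS ?mulr0 ?subrr// ltnW.
split=> // [|j ji].
  by rewrite pS !dot_linE r_pS// mulr0 addr0.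
have [rpj _ _] := IH j ji.
(* a zero step size means that the residual [res j] already vanished *)
have [aj0|aj0] := eqVneq (alpha j) 0.
  have rj0 : res j = 0.
    by apply/eqP; rewrite -dot_eq0 -cg_alphaE// aj0 mul0r.
  by rewrite (cg_dir_eq0 rj0) mulmx0 dot0r.
have [_ rjS _] := cg_rec j.
have Hpj : alpha j *: (H *m dir j) = res j - res j.+1.
  by rewrite rjS opprB addrCA subrr addr0.
apply: (mulfI aj0); rewrite mulr0 -dotZr Hpj pS dotDl dotZl.
move: ji; rewrite ltnS leq_eqVlt => /orP[/eqP ji|ji].
  rewrite -{2}Hpj dotZr ji cg_alphaE// cg_betaE dotDr dotNr r_r//.
  by rewrite add0r addNr.
rewrite -{2}Hpj dotZr p_Hp// !mulr0 addr0 dotDr dotNr !r_r ?subrr//.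
by rewrite ltnW.
Qed.

(** Galerkin orthogonality: the iterate is a combination of earlier directions,
    all of which are orthogonal to its residual. *)
Lemma cg_residual_orthogonal i :
  dot (g - H *m cg_iterate H g i) (cg_iterate H g i) = 0.
Proof.
rewrite -[cg_iterate H g i]/(sol i) -cg_res_sol.
suff /(_ i (leqnn i)): forall l, (l <= i)%N -> dot (res i) (sol l) = 0 by [].
elim=> [|l IH] li; first exact: dot0r.
have [-> _ _] := cg_rec l; have [_ r_p _] := cg_orthogonality i.
by rewrite !dot_linE IH ?r_p ?mulr0 ?addr0// ltnW.
Qed.

End ConjugateGradient.
(** * The Newton matrices *)

Lemma col_span_right_inverse (R : realType) (s n : nat) (M : 'M[R]_(s, n)) :
  <<codom (fun j => col j M)>>%VS = fullv ->
  exists W : 'M[R]_(n, s), M *m W = 1%:M.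
Proof.
move=> Mfull.
have preim (v : 'cV[R]_s) : exists w : 'cV[R]_n, M *m w = v.
  have : v \in <<codom_tuple (fun j => col j M)>>%VS by rewrite Mfull memvf.
  move=> /coord_span ->.
  exists (\sum_i coord (codom_tuple (fun j => col j M)) i v
                   *: delta_mx (enum_val i) 0).
  rewrite mulmx_sumr; apply: eq_bigr => i _.
  by rewrite -scalemxAr -colE nth_codom.
have [W hW] := choice (fun i : 'I_s => preim (delta_mx i 0)).
exists (\matrix_(j, i) W i j 0); apply/matrixP => i j.
have := congr1 (fun v : 'cV_s => v i 0) (hW j); rewrite !mxE eqxx andbT => <-.
by apply: eq_bigr => l _; rewrite mxE.
Qed.

Section NewtonMatrix.
Variables (R : realType) (m n s : nat).
Variables (A : 'M[R]_(m, n)) (B : 'M[R]_(s, n)) (lambda sigma : R).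
Hypotheses (lambda_gt0 : 0 < lambda) (sigma_gt0 : 0 < sigma).

Notation k := (sigma * lambda).
Notation Abar := (Abar A B).
Implicit Types (e : 'cV[R]_(m + s)) (z : 'cV[R]_n) (Q : 'M[R]_n).

(** [newton_sys] with its regularization parameter, which there depends on the
    gradient, as a free variable. *)
Definition shifted_newton_mx (eps : R) Q : 'M[R]_(m + s) :=
  newton_mx A B sigma Q + eps *: block_mx 0 0 0 1%:M.

Lemma newton_mx_mul Q e : newton_mx A B sigma Q *m e
  = col_mx (usubmx e) 0 + sigma *: (Abar *m (Q *m (Abar^T *m e))).
Proof.
rewrite /newton_mx mulmxDl -scalemxAl -!mulmxA; congr (_ + _).
by rewrite -{1}(vsubmxK e) mul_block_col !mul0mx mul1mx !addr0.
Qed.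

Lemma dot_newton_mx Q e e' : dot e' (newton_mx A B sigma Q *m e)
  = dot (usubmx e') (usubmx e)
    + sigma * dot (Abar^T *m e') (Q *m (Abar^T *m e)).
Proof.
rewrite newton_mx_mul dotDr dotZr -dot_mulmxr; congr (_ + _).
by rewrite dot_split col_mxKu col_mxKd dot0r addr0.
Qed.

Lemma dot_shifted_newton_mx eps Q e e' :
  dot e' (shifted_newton_mx eps Q *m e)
  = dot e' (newton_mx A B sigma Q *m e) + eps * dot (dsubmx e') (dsubmx e).
Proof.
rewrite /shifted_newton_mx mulmxDl dotDr -scalemxAl dotZr; congr (_ + _ * _).
rewrite -{1}(vsubmxK e) mul_block_col !mul0mx mul1mx addr0 add0r.
by rewrite dot_split col_mxKu col_mxKd dot0r add0r.
Qed.

Lemma shifted_newton_mx_sym z eps Q : soft_jacobian k z Q ->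
  (shifted_newton_mx eps Q)^T = shifted_newton_mx eps Q.
Proof.
move=> [Q0 _]; have QT : Q^T = Q.
  apply/matrixP => i j; rewrite mxE.
  by have [->//|ij] := eqVneq i j; rewrite !Q0// eq_sym.
rewrite /shifted_newton_mx /newton_mx !linearD !linearZ /= !tr_block_mx.
by rewrite !trmx_mul !trmxK QT !trmx0 !trmx1 mulmxA.
Qed.

Lemma newton_mx_psd z Q e : soft_jacobian k z Q ->
  0 <= dot e (newton_mx A B sigma Q *m e).
Proof.
move=> Qz; rewrite dot_newton_mx addr_ge0 ?dot_ge0//.
exact: mulr_ge0 (ltW sigma_gt0) (soft_jacobian_dot_ge0 _ Qz).
Qed.

Lemma newton_mx_le_shifted eps Q e : 0 <= eps ->
  dot e (newton_mx A B sigma Q *m e) <= dot e (shifted_newton_mx eps Q *m e).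
Proof. by move=> eps0; rewrite dot_shifted_newton_mx lerDl mulr_ge0 ?dot_ge0. Qed.

Lemma shifted_newton_mx_pd z eps Q e : soft_jacobian k z Q -> 0 < eps ->
  e != 0 -> 0 < dot e (shifted_newton_mx eps Q *m e).
Proof.
move=> Qz eps0; apply: contraNT; rewrite -leNgt dot_shifted_newton_mx dot_newton_mx.
have q0 := soft_jacobian_dot_ge0 (Abar^T *m e) Qz.
have := mulr_ge0 (ltW sigma_gt0) q0.
have u0 := dot_ge0 (usubmx e); have v0 := dot_ge0 (dsubmx e).
have := mulr_ge0 (ltW eps0) v0 => ? ? ?.
have /eqP : eps * dot (dsubmx e) (dsubmx e) = 0 by lra.
rewrite mulf_eq0 gt_eqF//= => /eqP v00.
by rewrite -dot_eq0 dot_split v00 addr0; apply/eqP; lra.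
Qed.

(** A single constant serves twice: it bounds the matrices of the linear systems
    and is a Lipschitz constant for the gradient of [theta]. *)
Lemma shifted_newton_mx_bounded : exists2 C, 0 < C &
  (forall e, dot (usubmx e) (usubmx e) + sigma * dot (Abar^T *m e) (Abar^T *m e)
             <= C * dot e e) /\
  (forall z eps Q, soft_jacobian k z Q -> 0 <= eps <= 1 ->
   forall e, enorm (shifted_newton_mx eps Q *m e) <= C * enorm e).
Proof.
have [a a0 ha] := mulmx_bounded Abar^T.
have C0 : 0 < 1 + sigma * a ^+ 2.
  by rewrite ltr_wpDr// mulr_ge0 ?sqr_ge0// ltW.
exists (1 + sigma * a ^+ 2) => //; split=> [e|z eps Q Qz /andP[eps0 eps1] e].
  have h : dot (Abar^T *m e) (Abar^T *m e) <= a ^+ 2 * dot e e.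
    by rewrite -!enorm_sqr -exprMn ler_sqr ?nnegrE ?enorm_ge0 ?mulr_ge0 ?enorm_ge0.
  have := ler_wpM2l (ltW sigma_gt0) h.
  by have := dot_split e e; have := dot_ge0 (dsubmx e); lra.
set f := _ *m e; have [f0|f0] := eqVneq (enorm f) 0.
  by rewrite f0 mulr_ge0 ?enorm_ge0// ltW.
have fp : 0 < enorm f by rewrite lt_neqAle eq_sym f0 enorm_ge0.
rewrite -(ler_pM2l fp) -expr2 enorm_sqr {2}/f dot_shifted_newton_mx dot_newton_mx.
have h1 : dot (usubmx f) (usubmx e) + eps * dot (dsubmx f) (dsubmx e)
    <= enorm f * enorm e.
  (* [eps <= 1] makes the block scaling nonexpansive *)
  pose e' := col_mx (usubmx e) (eps *: dsubmx e).
  have -> : dot (usubmx f) (usubmx e) + eps * dot (dsubmx f) (dsubmx e) = dot f e'.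
    by rewrite dot_split col_mxKu col_mxKd dotZr.
  apply: le_trans (dot_le_enorm _ _) _; rewrite ler_wpM2l ?enorm_ge0//.
  rewrite enorm_le ?enorm_ge0// enorm_sqr !dot_split col_mxKu col_mxKd lerD2l.
  rewrite !dot_linE mulrA ler_piMl ?dot_ge0//.
  by rewrite mulr_ile1.
have h2 : dot (Abar^T *m f) (Q *m (Abar^T *m e)) <= (a * enorm f) * (a * enorm e).
  apply: le_trans (dot_le_enorm _ _) _; apply: ler_pM; rewrite ?enorm_ge0//.
  by rewrite (le_trans (soft_jacobian_nonexpansive _ Qz)).
by have := ler_wpM2l (ltW sigma_gt0) h2; lra.
Qed.

(** The quadratic form controls the first block of [e] and the entries of
    [Abar^T *m e] that are active at [z].  If these vanish, so does the image of
    the second block under the active part of [B^T], which nondegeneracy makes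
    injective; a right inverse of the active part of [B] makes this
    quantitative.  The constant depends on [z] only, not on [Q]. *)
Lemma newton_mx_coercive z : constraint_nondegenerate B lambda sigma z ->
  exists2 c, 0 < c & forall z' Q, soft_jacobian k z' Q ->
    (forall i, k < `|z i 0| -> Q i i = 1) ->
    forall e, c * dot e e <= dot e (newton_mx A B sigma Q *m e).
Proof.
move=> /col_span_right_inverse; set D := Qhat _ _ _ => -[W hW].
have [C1 C10 hC1] := mulmx_bounded (W^T *m D *m A^T).
have [C2 C20 hC2] := mulmx_bounded W^T.
have DT : D^T = D by rewrite /D /Qhat tr_diag_mx.
pose K := 1 + 2 * C1 ^+ 2 + 2 * C2 ^+ 2 * sigma^-1.
have K0 : 0 < K.
  rewrite /K -addrA ltr_pwDl// addr_ge0// !mulr_ge0 ?sqr_ge0// invr_ge0 ltW//.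
exists K^-1 => [|z' Q Qz' Q1 e]; first by rewrite invr_gt0.
rewrite ler_pdivrMl// dot_newton_mx.
set a := Abar^T *m e; set u := usubmx e; set v := dsubmx e.
(* the right inverse recovers the second block from the first one and from
   the active entries of [a] *)
have vE : v = W^T *m D *m A^T *m u - W^T *m (D *m a).
  rewrite /a tr_Abar_mul -/u -/v !mulmxBr !mulmxA opprB addrCA subrr addr0.
  by rewrite -[LHS]mul1mx -[X in X *m v]trmx1 -hW !trmx_mul DT !mulmxA.

have Da : dot (D *m a) (D *m a) <= dot a (Q *m a).
  rewrite (dot_soft_jacobian _ Qz') dotE; apply: ler_sum => i _.
  rewrite /D /Qhat mul_diag_mx !mxE; case: ifP => zi.
    by rewrite Q1// !mul1r expr2.
  rewrite !mul0r mulr_ge0 ?sqr_ge0//.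
  by have [_ /(_ i) [/andP[]]] := Qz'.
have vn : enorm v <= C1 * enorm u + C2 * enorm (D *m a).
  rewrite vE (le_trans (enormD _ _))// enormN lerD//.
have hv : dot v v <= 2 * C1 ^+ 2 * dot u u + 2 * C2 ^+ 2 * dot (D *m a) (D *m a).
  rewrite -!enorm_sqr.
  apply: (@le_trans _ _ ((C1 * enorm u + C2 * enorm (D *m a)) ^+ 2)).
    by rewrite ler_sqr ?nnegrE ?enorm_ge0// addr_ge0 ?mulr_ge0 ?enorm_ge0.
  by have := sqr_ge0 (C1 * enorm u - C2 * enorm (D *m a)); lra.
have hq := ler_wpM2l (sqr_ge0 C2) Da.
have q0 : 0 <= dot a (Q *m a) by exact: le_trans (dot_ge0 _) Da.
have u0 := dot_ge0 u.
have -> : dot e e = dot u u + dot v v by rewrite dot_split.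
have e1 : 0 <= C1 ^+ 2 * (sigma * dot a (Q *m a)).
  by rewrite mulr_ge0 ?sqr_ge0// mulr_ge0// ltW.
have e2 : 0 <= C2 ^+ 2 * sigma^-1 * dot u u.
  by rewrite mulr_ge0// mulr_ge0 ?sqr_ge0// invr_ge0 ltW.
have e3 : C2 ^+ 2 * sigma^-1 * (sigma * dot a (Q *m a)) = C2 ^+ 2 * dot a (Q *m a).
  by rewrite -mulrA mulKf// gt_eqF.
have e4 := mulr_ge0 (ltW sigma_gt0) q0.
have -> : K * (dot u u + sigma * dot a (Q *m a)) = dot u u + 2 * (C1 ^+ 2 * dot u u)
   + 2 * (C2 ^+ 2 * sigma^-1 * dot u u) + sigma * dot a (Q *m a)
   + 2 * (C1 ^+ 2 * (sigma * dot a (Q *m a)))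
   + 2 * (C2 ^+ 2 * sigma^-1 * (sigma * dot a (Q *m a))).
  by rewrite /K; ring.
rewrite e3; lra.
Qed.

End NewtonMatrix.
(** * The exact quadratic model around a point *)

Section LocalModel.
Variables (R : realType) (m n s : nat).
Variables (A : 'M[R]_(m, n)) (b : 'cV[R]_m) (B : 'M[R]_(s, n)) (d : 'cV[R]_s).
Variables (lambda sigma : R) (x : 'cV[R]_n).
Hypotheses (lambda_gt0 : 0 < lambda) (sigma_gt0 : 0 < sigma).

Notation k := (sigma * lambda).
Notation zarg := (prox_arg A B sigma x).
Notation theta := (theta A b B d lambda sigma x).
Notation grad := (theta_grad A b B d lambda sigma x).
Notation Abar := (Abar A B).
Notation V := (newton_mx A B sigma).
Implicit Types (y h : 'cV[R]_(m + s)).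

Lemma gradient_thetaE y : gradient theta y = grad y.
Proof.
have [C C0 [hC _]] := shifted_newton_mx_bounded A B lambda sigma_gt0.
apply/colP => i; rewrite mxE.
rewrite (@derive_quadratic_error _ _ theta y (grad y) _ C).
  move: (grad y) => g; rewrite dotE (bigD1 i)//= !mxE !eqxx mulr1 big1 ?addr0// => j ji.
  by rewrite mxE (negbTE ji) mulr0.
move=> h; have /andP[h0 h1] := theta_expansion A b B d x lambda_gt0 sigma_gt0 y h.
rewrite ger0_norm//; apply: le_trans h1 _.
by have := hC h; have := mulr_ge0 (ltW C0) (dot_ge0 h); lra.
Qed.

(** The Jacobian is taken at the nearby point [y], where the algorithm evaluates
    it, and not at the centre [y0]; [softv_exact] is what allows this. *)
Lemma theta_local_model y0 : exists2 rho, 0 < rho & forall y Q,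
  enorm (y - y0) < rho -> soft_jacobian k (zarg y) Q ->
  [/\ grad y = grad y0 + V Q *m (y - y0),
      theta y = theta y0 + dot (grad y0) (y - y0)
                + 2^-1 * dot (y - y0) (V Q *m (y - y0))
    & forall i, k < `|zarg y0 i 0| -> Q i i = 1].
Proof.
have [r r0 hr] := softv_exact (threshold_gt0 lambda_gt0 sigma_gt0) (zarg y0).
have [a a0 ha] := mulmx_bounded Abar^T.
have a1 : 0 < a + 1 by lra.
exists (r / (sigma * (a + 1))) => [|y Q yy0 Qy].
  by rewrite divr_gt0// mulr_gt0.
set h := y - y0; have yE : y = y0 + h by rewrite addrC subrK.
have zE : zarg y - zarg y0 = - sigma *: (Abar^T *m h).
  by rewrite yE prox_argD addrC addKr scaleNr.
have [|S1 S2 S3] := hr (zarg y) Q _ Qy.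
  rewrite zE enormZ normrN gtr0_norm//.
  move: yy0; rewrite ltr_pdivlMr ?mulr_gt0// -/h; apply: le_lt_trans.
  rewrite mulrCA ler_pM2l// (le_trans (ha h))// mulrC ler_wpM2l ?enorm_ge0//; lra.
split=> //.
- rewrite newton_mx_mul /theta_grad.
  have -> : softv k (zarg y) = softv k (zarg y0) - sigma *: (Q *m (Abar^T *m h)).
    rewrite -scaleNr scalemxAr -zE -S1 addrC subrK//.
  have -> : col_mx (usubmx y + b) (- d)
      = col_mx (usubmx y0 + b) (- d) + col_mx (usubmx h) 0.
    by rewrite add_col_mx addr0 yE linearD /= addrAC.
  rewrite mulmxBr -scalemxAr; move: (Abar *m _) (sigma *: _) => p q.
  by rewrite opprB [q - p]addrC addrACA.
- rewrite dot_newton_mx.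
  rewrite zE -!scalemxAr !dot_linE in S2; clear yy0 zE S1; clearbody h.
  rewrite !thetaE// /theta_grad /hstar !enorm_sqr.
  have s0 : sigma != 0 by rewrite gt_eqF.
  have -> : dot (softv k (zarg y)) (softv k (zarg y)) =
     2 * (2^-1 * dot (softv k (zarg y)) (softv k (zarg y)) -
          2^-1 * dot (softv k (zarg y0)) (softv k (zarg y0))) +
     dot (softv k (zarg y0)) (softv k (zarg y0)) by field.
  rewrite S2 !dot_linE (dot_mulmxl Abar) (dot_split (col_mx _ _)).
  rewrite col_mxKu col_mxKd yE !linearD /=.
  rewrite !dot_linE (dotC (usubmx h) (usubmx y0)) (dotC d).
  by field.
Qed.

End LocalModel.
(** * Sequences and the Euclidean norm *)

Lemma frequently_near (R : realType) p (y : nat -> 'cV[R]_p) (y0 : 'cV[R]_p) :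
  cluster (y @ \oo) y0 ->
  forall (r : R) N, 0 < r -> exists2 j, (N <= j)%N & enorm (y j - y0) < r.
Proof.
move=> yy0 r N r0.
pose q := Num.sqrt p%:R + 1 : R.
have q0 : 0 < q by rewrite ltr_wpDl// sqrtr_ge0.
have [|| _ [[j Nj <-] yj]] := yy0 [set y j | j in [set j | (N <= j)%N]]
    [set y' | `|y' - y0| < r / q].
- by exists N => // j Nj; exists j.
- apply/nbhs_ballP; exists (r / q) => /=; first exact: divr_gt0.
  by move=> y'; rewrite -ball_normE /= distrC.
exists j => //; apply: le_lt_trans (enorm_le_normr _) _.
apply: (@le_lt_trans _ _ (q * `|y j - y0|)); first by rewrite ler_wpM2r// lerDl.
by rewrite mulrC -ltr_pdivlMr.
Qed.

Lemma cvg_of_enorm (R : realType) p (y : nat -> 'cV[R]_p) (y0 : 'cV[R]_p) :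
  (forall r, 0 < r -> exists N, forall j, (N <= j)%N -> enorm (y j - y0) < r) ->
  y @ \oo --> y0.
Proof.
move=> h; apply/cvgrPdist_lt => r r0; have [N hN] := h r r0.
exists N => // j /= Nj; rewrite distrC.
exact: le_lt_trans (normr_le_enorm _) (hN j Nj).
Qed.

(** * One step of the algorithm *)

(** The inexactness tolerance is a fixed fraction of the gradient, whatever its
    size: the two terms of the minimum cross at
    [G = etabar `^ (1 + tau)^-1], where both equal
    [etabar `^ (tau / (1 + tau)) * G]. *)
Lemma min_powR_contraction (R : realType) (etabar tau : R) :
  0 < etabar < 1 -> 0 < tau -> exists2 kappa, kappa < 1 &
  forall G, 0 <= G -> Num.min etabar (G `^ (1 + tau)) <= kappa * G.
Proof.
move=> /andP[e0 e1] t0; have t1 : 0 < 1 + tau by rewrite addr_gt0.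
exists (etabar `^ (tau / (1 + tau))) => [|G G0].
  rewrite [ltRHS](_ : 1 = 1 `^ (tau / (1 + tau))); last by rewrite powR1.
  apply: gt0_ltr_powR; rewrite ?nnegrE ?ltW// divr_gt0//.
pose th := etabar `^ (1 + tau)^-1.
have thE : th `^ (1 + tau) = etabar.
  by rewrite /th -powRrM mulVf ?gt_eqF// powRr1// ltW.
have th0 : 0 < th by exact: powR_gt0.
have kE : etabar `^ (tau / (1 + tau)) = th `^ tau.
  by rewrite /th -powRrM mulrC.
have SE (u : R) : 0 <= u -> u `^ (1 + tau) = u * u `^ tau.
  move=> u0; rewrite powRD ?powRr1//.
  by rewrite (gt_eqF t1).
rewrite kE ge_min -thE (SE _ (ltW th0)) (SE _ G0); case: (leP th G) => Gth; apply/orP.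
  by left; rewrite mulrC ler_wpM2l// powR_ge0.
right; rewrite mulrC ler_wpM2r//; apply: ge0_ler_powR; rewrite ?nnegrE// ltW//.
Qed.

Section SemismoothNewton.
Variables (R : realType) (m n s : nat).
Variables (A : 'M[R]_(m, n)) (b : 'cV[R]_m) (B : 'M[R]_(s, n)) (d : 'cV[R]_s).
Variables (lambda sigma : R) (x : 'cV[R]_n) (mu etabar tau tau1 tau2 delta : R).
Hypotheses (lambda_gt0 : 0 < lambda) (sigma_gt0 : 0 < sigma).
Hypotheses (mu_itv : 0 < mu < 2^-1) (etabar_itv : 0 < etabar < 1).
Hypotheses (tau_itv : 0 < tau <= 1) (tau1_itv : 0 < tau1 < 1).
Hypotheses (tau2_itv : 0 < tau2 < 1) (delta_itv : 0 < delta < 1).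

Notation k := (sigma * lambda).
Notation zarg := (prox_arg A B sigma x).
Notation theta := (theta A b B d lambda sigma x).
Notation grad := (theta_grad A b B d lambda sigma x).
Notation V := (newton_mx A B sigma).
Notation H := (shifted_newton_mx A B sigma).
Notation step := (ssn_step A b B d lambda sigma x mu etabar tau tau1 tau2 delta).
Notation armijo := (armijo A b B d lambda sigma x mu delta).
Implicit Types (y e h : 'cV[R]_(m + s)).

(** Unfolds a step in terms of the explicit gradient.  The equality for the slope
    [dot (grad y) e] is the orthogonality of the residual to [e]; it needs
    [grad y != 0] because otherwise the regularization vanishes, the matrix may
    be singular, and the conjugate gradient argument does not apply. *)
Lemma ssn_stepE y y' : step y y' -> exists Q eps e l,
  [/\ [/\ soft_jacobian k (zarg y) Q,
      0 <= eps <= 1, eps <= enorm (grad y) & grad y != 0 -> 0 < eps],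
      enorm (H eps Q *m e + grad y) <= Num.min etabar (enorm (grad y) `^ (1 + tau)),
      grad y != 0 -> dot (grad y) e = - dot e (H eps Q *m e)
    & [/\ armijo y e l, forall l', (l' < l)%N -> ~ armijo y e l'
      & y' = y + delta ^+ l *: e]].
Proof.
move=> [Q [e [l [clarkeQ]]]]; rewrite /newton_dir /newton_sys.
set eps := newton_reg _ _ _ _ _ _ _ _ _ _.
rewrite -/(H eps Q) gradient_thetaE// => -[He res_le] arm nolt y'E.
have Qz : soft_jacobian k (zarg y) Q.
  apply: clarke_soft; first exact: threshold_gt0.
  move: clarkeQ; rewrite (_ : lasso_prox lambda sigma = softv k)//.
  by apply/funext => z; exact: lasso_proxE.
have epsE : eps = tau1 * Num.min tau2 (enorm (grad y)).
  by rewrite /eps /newton_reg gradient_thetaE.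
have [/andP[a0 a1] /andP[c0 c1]] := (tau1_itv, tau2_itv).
have min0 : 0 <= Num.min tau2 (enorm (grad y)) by rewrite le_min enorm_ge0 ltW.
have eps_le : eps <= Num.min tau2 (enorm (grad y)) by rewrite epsE ler_piMl// ltW.
have eps0 : 0 <= eps by rewrite epsE mulr_ge0// ltW.
have eps_gt0 : grad y != 0 -> 0 < eps.
  move=> g0; rewrite epsE mulr_gt0// lt_min c0 lt_neqAle enorm_ge0 andbT.
  by rewrite eq_sym enorm_eq0.
exists Q, eps, e, l; split=> //.
- move: eps_le; rewrite le_min => /andP[eps2 ->]; split=> //.
  by rewrite eps0 (le_trans eps2)// ltW.
- move=> g0; case: He => [->|[i eE]].
    by rewrite dotNr opprK dotC.
  have H_pd e' : e' != 0 -> 0 < dot e' (H eps Q *m e').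
    exact: shifted_newton_mx_pd Qz (eps_gt0 g0).
  have := cg_residual_orthogonal (- grad y)
    (shifted_newton_mx_sym A B eps Qz) H_pd i.
  rewrite -eE dotDl !dotNl (dotC (H _ _ *m _)); lra.
Qed.

Lemma ssn_step_descent y y' : step y y' -> theta y' <= theta y.
Proof.
move=> /ssn_stepE[Q [eps [e [l [[Qz /andP[eps0 _] _ _] _ ge [arm _ ->]]]]]].
apply: le_trans arm _; rewrite gradient_thetaE// gerDl.
have [/andP[m0 _] /andP[d0 _]] := (mu_itv, delta_itv).
rewrite pmulr_rle0; last by rewrite mulr_gt0// exprn_gt0.
have [->|/ge ->] := eqVneq (grad y) 0; first by rewrite dot0l.
rewrite oppr_le0; apply: le_trans (newton_mx_psd A B sigma_gt0 e Qz) _.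
exact: newton_mx_le_shifted.
Qed.

Variable yhat : 'cV[R]_(m + s).
Hypothesis nondegenerate : constraint_nondegenerate B lambda sigma (zarg yhat).

(** Collects coercivity, boundedness and the exact model with constants common
    to all the linear systems that can arise near [yhat]. *)
Lemma newton_system_near : exists C c rho : R, [/\ 0 < C, 0 < c, 0 < rho,
  forall y h, theta y + dot (grad y) h <= theta (y + h)
      <= theta y + dot (grad y) h + C / 2 * dot h h
  & forall y Q, enorm (y - yhat) < rho -> soft_jacobian k (zarg y) Q ->
    [/\ grad y = grad yhat + V Q *m (y - yhat),
        theta y = theta yhat + dot (grad yhat) (y - yhat)
                  + 2^-1 * dot (y - yhat) (V Q *m (y - yhat)),
        enorm (V Q *m (y - yhat)) <= C * enorm (y - yhat),
        forall e, c * dot e e <= dot e (V Q *m e)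
      & forall eps e, 0 <= eps <= 1 -> enorm (H eps Q *m e) <= C * enorm e]].
Proof.
have [C C0 [hC hH]] := shifted_newton_mx_bounded A B lambda sigma_gt0.
have [c c0 hc] := newton_mx_coercive A sigma_gt0 nondegenerate.
have [rho rho0 hrho] := theta_local_model A b B d x lambda_gt0 sigma_gt0 yhat.
exists C, c, rho; split=> // [y h|y Q yrho Qz].
  have := theta_expansion A b B d x lambda_gt0 sigma_gt0 y h; have := hC h.
  move: (theta (y + h)) (theta y) (dot (grad y) h) (dot h h) => t t' p q.
  by move=> ? /andP[? ?]; apply/andP; split; lra.
have [g1 g2 g3] := hrho y Q yrho Qz; split=> //.
- have := hH _ 0 Q Qz _ (y - yhat); rewrite /shifted_newton_mx scale0r addr0.
  by apply; rewrite lexx ler01.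
- exact: hc Qz g3.
- by move=> eps e eps01; exact: hH Qz eps01 e.
Qed.

(** A rejected trial step has length at least [2 * (1 - mu) * c / C], by the
    descent lemma and coercivity, so the accepted one is at least [delta] times
    that.  The direction is not too short either, since [H e] differs from the
    negative gradient by at most the fraction [kappa] of its length. *)
Lemma ssn_step_decrease C c y y' : 0 < C -> 0 < c ->
  (forall h, theta (y + h) <= theta y + dot (grad y) h + C / 2 * dot h h) ->
  (forall Q, soft_jacobian k (zarg y) Q ->
     (forall e, c * dot e e <= dot e (V Q *m e)) /\
     forall eps e, 0 <= eps <= 1 -> enorm (H eps Q *m e) <= C * enorm e) ->
  forall kappa, kappa < 1 ->
  (forall G, 0 <= G -> Num.min etabar (G `^ (1 + tau)) <= kappa * G) ->
  step y y' -> grad y != 0 ->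
  theta y' <= theta y - mu * Num.min 1 (delta * (2 * (1 - mu) * c / C)) * c
                        * ((1 - kappa) * enorm (grad y) / C) ^+ 2.
Proof.
move=> C0 c0 theta_ub hV kappa k1 hk.
move=> /ssn_stepE[Q [eps [e [l [[Qz eps01 _ _] res_le ge [arm nolt ->]]]]]] g0.
have {hV}[Vc HC] := hV Q Qz; have /andP[eps0 _] := eps01.
have [/andP[m0 m1] /andP[d0 d1]] := (mu_itv, delta_itv).
set G := enorm (grad y); set t0 := Num.min _ _.
have cge : c * dot e e <= - dot (grad y) e.
  by rewrite ge// opprK (le_trans (Vc e))// newton_mx_le_shifted.
have e_ge : (1 - kappa) * G / C <= enorm e.
  rewrite ler_pdivrMr// [leRHS]mulrC.
  have : G <= enorm (H eps Q *m e) + enorm (H eps Q *m e + grad y).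
    rewrite -[X in _ <= X + _]enormN; apply: le_trans (enormD _ _).
    by rewrite addKr.
  have := hk G (enorm_ge0 _); have := HC eps e eps01.
  by rewrite -/G in res_le; lra.
have t_ge : t0 <= delta ^+ l.
  case: l nolt {arm} => [_|l nolt]; first by rewrite expr0 ge_min lexx.
  rewrite ge_min; apply/orP; right; rewrite exprS ler_pM2l// leNgt; apply/negP => lt.
  apply: (nolt l (ltnSn l)); rewrite /Defs.armijo gradient_thetaE//.
  have t0' : 0 < delta ^+ l by exact: exprn_gt0.
  apply: le_trans (theta_ub _) _; rewrite !dotZr dotZl.
  have h1 : C / 2 * delta ^+ l <= (1 - mu) * c.
    have : delta ^+ l * C < 2 * (1 - mu) * c by rewrite -ltr_pdivlMr.
    lra.
  have h2 := ler_wpM2r (dot_ge0 e) h1.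
  have m1' : 0 <= 1 - mu by lra.
  have h3 := ler_wpM2l m1' cge.
  have h4 : C / 2 * delta ^+ l * dot e e <= (1 - mu) * - dot (grad y) e by lra.
  have := ler_wpM2l (ltW t0') h4.
  move: (delta ^+ l) (dot (grad y) e) (dot e e) (theta y) => t p q th; lra.
have t00 : 0 < t0.
  by rewrite lt_min ltr01 /= mulr_gt0// divr_gt0// !mulr_gt0//; lra.
apply: le_trans arm _; rewrite gradient_thetaE// lerD2l.
have k1' : 0 <= (1 - kappa) * G / C.
  by rewrite divr_ge0 ?mulr_ge0 ?enorm_ge0 ?ltW//; lra.
have e2 : ((1 - kappa) * G / C) ^+ 2 <= dot e e.
  by rewrite -enorm_sqr ler_sqr ?nnegrE ?enorm_ge0.
have a1 := ler_wpM2l (ltW c0) e2.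
have a2 : t0 * (c * ((1 - kappa) * G / C) ^+ 2) <= delta ^+ l * - dot (grad y) e.
  apply: ler_pM => //; first exact: ltW.
    by rewrite mulr_ge0 ?sqr_ge0// ltW.
  exact: le_trans a1 cge.
have := ler_wpM2l (ltW m0) a2; lra.
Qed.

End SemismoothNewton.
(** At the unit step, the model value [C / 2 * w] of the new iterate must lie
    below the Armijo bound; the strict inequality [mu < 1 / 2] is what leaves
    room for errors of relative size [eta]. *)
Lemma unit_step_model (R : realType) (mu C c eta N q p w : R) :
  0 < mu < 2^-1 -> 0 < C -> 0 <= eta <= 1 -> C * eta <= (2^-1 - mu) * c ->
  c * N ^+ 2 <= q -> - (C * N * (eta * N)) <= p -> w <= (eta * N) ^+ 2 ->
  C / 2 * w <= 2^-1 * q + mu * (p - q).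
Proof.
move=> /andP[m0 m1] C0 /andP[eta0 eta1] etaC q_ge p_ge w_le.
have N2 := sqr_ge0 N.
have CN0 : 0 <= C * eta * N ^+ 2 by rewrite mulr_ge0// mulr_ge0// ltW.
have i0 := ler_wpM2r N2 etaC.
have m1' : 0 <= 2^-1 - mu by lra.
have i1 := ler_wpM2l m1' q_ge.
have i2 := ler_wpM2l (ltW C0) w_le.
have i3 := ler_piMr CN0 eta1.
have i4 := ler_wpM2l (ltW m0) p_ge.
have i5 := ler_wpM2r CN0 (ltW m1).
by lra.
Qed.

(** * Convergence *)

Section Convergence.
Variables (R : realType) (m n s : nat).
Variables (A : 'M[R]_(m, n)) (b : 'cV[R]_m) (B : 'M[R]_(s, n)) (d : 'cV[R]_s).
Variables (lambda sigma : R) (x : 'cV[R]_n) (mu etabar tau tau1 tau2 delta : R).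
Hypotheses (lambda_gt0 : 0 < lambda) (sigma_gt0 : 0 < sigma).
Hypotheses (mu_itv : 0 < mu < 2^-1) (etabar_itv : 0 < etabar < 1).
Hypotheses (tau_itv : 0 < tau <= 1) (tau1_itv : 0 < tau1 < 1).
Hypotheses (tau2_itv : 0 < tau2 < 1) (delta_itv : 0 < delta < 1).

Notation k := (sigma * lambda).
Notation zarg := (prox_arg A B sigma x).
Notation theta := (theta A b B d lambda sigma x).
Notation grad := (theta_grad A b B d lambda sigma x).
Notation V := (newton_mx A B sigma).
Notation H := (shifted_newton_mx A B sigma).
Notation step := (ssn_step A b B d lambda sigma x mu etabar tau tau1 tau2 delta).
Notation armijo := (armijo A b B d lambda sigma x mu delta).
Implicit Types (y e h : 'cV[R]_(m + s)).

Variable yhat : 'cV[R]_(m + s).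
Hypothesis nondegenerate : constraint_nondegenerate B lambda sigma (zarg yhat).

(** Near a nonstationary [yhat] each step would decrease [theta] by a fixed
    amount; a single such step from a point with [theta (y j)] close enough to
    [theta yhat] leads below [theta yhat], and monotonicity then keeps all
    later iterates away from [yhat]. *)
Lemma ssn_cluster_stationary (y : nat -> 'cV[R]_(m + s)) :
  (forall j, step (y j) (y j.+1)) -> cluster (y @ \oo) yhat -> grad yhat = 0.
Proof.
move=> steps /frequently_near freq; apply: contrapT => /eqP g0.
have [C [c [rho [C0 c0 rho0 quad near]]]] :=
  newton_system_near b d lambda_gt0 sigma_gt0 nondegenerate.
have [kappa k1 hk] := min_powR_contraction etabar_itv (proj1 (andP tau_itv)).
have [/andP[m0 m1] /andP[d0 d1]] := (mu_itv, delta_itv).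
have mu1 : 0 < 1 - mu by lra.
have kappa1 : 0 < 1 - kappa by lra.
have theta_mono i j : (i <= j)%N -> theta (y j) <= theta (y i).
  elim: j => [|j IH]; first by rewrite leqn0 => /eqP ->.
  rewrite leq_eqVlt => /orP[/eqP ->//|/IH]; apply: le_trans.
  exact: ssn_step_descent (steps j).
set G := enorm (grad yhat).
have G0 : 0 < G by rewrite lt_neqAle enorm_ge0 andbT eq_sym enorm_eq0.
have theta_lb j : theta yhat <= theta (y j).
  apply/ler_addgt0Pr => r r0; have [i ji hi] := freq (r / G) j (divr_gt0 r0 G0).
  apply: le_trans (lerD (theta_mono _ _ ji) (lexx r)).
  have := quad yhat (y i - yhat); rewrite [yhat + _]addrC subrK => /andP[+ _].
  rewrite -lerBlDr; apply: le_trans; rewrite lerD2l.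
  apply: le_trans (dot_ge_enorm _ _); rewrite lerN2 mulrC ltW//.
  by rewrite -ltr_pdivlMr.
(* the decrease guaranteed by [ssn_step_decrease] where the gradient has length
   at least [G / 2] *)
pose D := mu * Num.min 1 (delta * (2 * (1 - mu) * c / C)) * c
          * ((1 - kappa) * (G / 2) / C) ^+ 2.
have t0 : 0 < mu * Num.min 1 (delta * (2 * (1 - mu) * c / C)) * c.
  rewrite mulr_gt0// mulr_gt0// lt_min ltr01 /= mulr_gt0// divr_gt0// !mulr_gt0//.
have G2 : 0 < G / 2 by rewrite divr_gt0.
have w0 : 0 < (1 - kappa) * (G / 2) / C by rewrite divr_gt0// mulr_gt0.
have D0 : 0 < D by rewrite mulr_gt0// exprn_gt0.
pose r := Num.min (Num.min rho 1) (Num.min (G / 2 / C) (D / (G + C))).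
have r0 : 0 < r.
  by rewrite !lt_min rho0 ltr01 !(divr_gt0, addr_gt0).
have [j _] := freq r 0%N r0.
rewrite !lt_min => /andP[/andP[j1 j2] /andP[j3 j4]].
set h := y j - yhat in j1 j2 j3 j4.
have hn := enorm_ge0 h.
have [Q [eps [e [l [[Qz _ _ _] _ _ _]]]]] :=
  ssn_stepE lambda_gt0 sigma_gt0 tau1_itv tau2_itv (steps j).
have near_y Q' := near (y j) Q' j1.
have [gE _ Vh _ _] := near_y Q Qz; rewrite -/h in gE Vh.
have Gj : G / 2 <= enorm (grad (y j)).
  have : G <= enorm (grad (y j)) + enorm (V Q *m h).
    rewrite -[X in _ <= _ + X]enormN; apply: le_trans (enormD _ _).
    by rewrite gE addrK.
  rewrite [X in X <= _](splitr G) => /le_trans/(_ (lerD (lexx _) Vh)) Gle.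
  rewrite -(lerD2r (G / 2)); apply: le_trans Gle _; rewrite lerD2l ltW// mulrC.
  by rewrite -ltr_pdivlMr.
have gj0 : grad (y j) != 0.
  by rewrite -enorm_eq0 (gt_eqF (lt_le_trans G2 Gj)).
have dec := ssn_step_decrease lambda_gt0 sigma_gt0 mu_itv tau1_itv tau2_itv
  delta_itv C0 c0 _ _ k1 hk (steps j) gj0.
have {dec} : theta (y j.+1) <= theta (y j) - D.
  apply: le_trans (dec _ _) _.
  - by move=> h'; have /andP[] := quad (y j) h'.
  - by move=> Q' Qz'; have [_ _ _ ? ?] := near_y Q' Qz'.
  - rewrite lerD2l lerN2 ler_wpM2l ?(ltW t0)// ler_sqr ?nnegrE; last 2 first.
    + exact: ltW.
    + by rewrite divr_ge0 ?mulr_ge0 ?enorm_ge0 ?(ltW C0) ?(ltW kappa1).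
    by rewrite ler_pM2r ?invr_gt0// ler_pM2l.
have := theta_lb j.+1.
have : theta (y j) < theta yhat + D.
  have := quad yhat h; rewrite /h [yhat + _]addrC subrK -/h => /andP[_].
  move=> /le_lt_trans; apply; rewrite -addrA ltrD2l.
  have hh : dot h h <= enorm h by rewrite -enorm_sqr expr2 ler_piMr// ltW.
  have {}j4 : enorm h * (G + C) < D by rewrite -(ltr_pdivlMr _ _ (addr_gt0 G0 C0)).
  apply: le_lt_trans j4.
  rewrite mulrDr lerD//; first by rewrite mulrC dot_le_enorm.
  rewrite mulrC; apply: ler_pM => //; first exact: dot_ge0.
    by rewrite divr_ge0// ltW.
  by rewrite ler_pdivrMr// mulr_natr mulr2n lerDl ltW.
move=> lt_j /le_trans/[apply]; rewrite lerBrDr.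
by move=> /le_lt_trans/(_ lt_j); rewrite ltxx.
Qed.

Lemma enorm_dsubmx_le (p q : nat) (h : 'cV[R]_(p + q)) :
  enorm (dsubmx h) <= enorm h.
Proof.
by rewrite enorm_le ?enorm_ge0// enorm_sqr [leRHS]dot_split lerDr dot_ge0.
Qed.

(** Since [H *m (h + e)] is the residual plus [eps] times the second block of
    [h], coercivity of [H] bounds the new error; [eps <= enorm (grad y)] makes
    the regularization cost only a quadratic term.  The radius is chosen so
    that the new error is at most [eta] times the old one, with [eta] small
    enough for [unit_step_model]. *)
Lemma ssn_local_step : grad yhat = 0 -> exists2 rho, 0 < rho & exists2 K, 0 < K &
  forall y y', enorm (y - yhat) < rho -> step y y' ->
    enorm (y' - yhat) <= K * enorm (y - yhat) `^ (1 + tau) /\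
    enorm (y' - yhat) <= enorm (y - yhat).
Proof.
move=> ghat0; have /andP[ta0 ta1] := tau_itv.
have [/andP[m0 m1] /andP[a0 a1]] := (mu_itv, tau1_itv).
have [C [c [rho [C0 c0 rho0 quad near]]]] :=
  newton_system_near b d lambda_gt0 sigma_gt0 nondegenerate.
have t1 : 0 < 1 + tau by rewrite addr_gt0.
have tau_le2 : 1 + tau <= 2 by rewrite -[2]/(1 + 1) lerD2l.
pose K := (C `^ (1 + tau) + C) / c.
have K0 : 0 < K by rewrite divr_gt0// ltr_pwDr// powR_ge0.
pose eta := Num.min 1 ((2^-1 - mu) * c / C).
have eta0 : 0 < eta by rewrite lt_min ltr01 divr_gt0// mulr_gt0// subr_gt0.
exists (Num.min (Num.min rho 1) ((eta / K) `^ tau^-1)).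
  by rewrite !lt_min rho0 ltr01 powR_gt0// divr_gt0.
exists K => // y y'; rewrite !lt_min => /andP[/andP[hrho h1] heta].
move=> /(ssn_stepE lambda_gt0 sigma_gt0 tau1_itv tau2_itv).
move=> [Q [eps [e [l [[Qz eps01 eps_g _] res_le _ [arm nolt ->]]]]]].
have [gE thE Vh Vc _] := near y Q hrho Qz; have /andP[eps0 _] := eps01.
set h := y - yhat in hrho h1 heta gE thE Vh *.
rewrite ghat0 add0r in gE; rewrite ghat0 dot0l addr0 in thE.
have hn := enorm_ge0 h.
pose h' := h + e; pose N := enorm h; pose P := N `^ (1 + tau).
have G_le : enorm (grad y) <= C * N by rewrite gE.
have N2P : N ^+ 2 <= P.
  have [N0|N0] := eqVneq N 0; first by rewrite N0 expr0n /= powR_ge0.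
  rewrite -(powR_mulrn 2 hn); apply: ger_powR; last exact: tau_le2.
  by rewrite lt_neqAle eq_sym N0 hn ltW.
have step_le : enorm h' <= K * P.
  have [h'0|h'0] := eqVneq (enorm h') 0.
    by rewrite h'0 mulr_ge0 ?powR_ge0// ltW.
  have h'p : 0 < enorm h' by rewrite lt_neqAle eq_sym h'0 enorm_ge0.
  have P1 : c * enorm h' <= enorm (H eps Q *m e + grad y) + eps * N.
    rewrite -(ler_pM2l h'p); apply: (@le_trans _ _ (dot h' (H eps Q *m h'))).
      rewrite mulrCA -expr2 enorm_sqr (le_trans (Vc h'))//.
      exact: newton_mx_le_shifted.
    have -> : dot h' (H eps Q *m h') = dot h' (H eps Q *m e + grad y)
        + eps * dot (dsubmx h') (dsubmx h).
      by rewrite {2}/h' mulmxDr dotDr dot_shifted_newton_mx -gE [in RHS]dotDr addrC addrA.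
    rewrite mulrDr lerD ?dot_le_enorm// mulrCA ler_wpM2l//.
    apply: le_trans (dot_le_enorm _ _) _.
    by apply: ler_pM; rewrite ?enorm_ge0 ?enorm_dsubmx_le.
  have P2 : enorm (H eps Q *m e + grad y) <= C `^ (1 + tau) * P.
    apply: le_trans res_le _; rewrite ge_min; apply/orP; right.
    rewrite /P -powRM ?(ltW C0)//; apply: ge0_ler_powR; rewrite ?nnegrE ?enorm_ge0//.
      exact: ltW.
    by rewrite mulr_ge0// ltW.
  have P3 : eps * N <= C * P.
    apply: (@le_trans _ _ (C * N * N)).
      by rewrite ler_wpM2r// (le_trans eps_g).
    by rewrite -mulrA -expr2 ler_pM2l.
  rewrite /K mulrAC ler_pdivlMr// mulrC (le_trans P1)// mulrDl.
  exact: lerD P2 P3.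
have small : enorm h' <= eta * N.
  apply: le_trans step_le _.
  have -> : P = N * N `^ tau.
    by rewrite /P powRD ?powRr1// gt_eqF.
  rewrite mulrCA mulrC ler_wpM2r// mulrC -ler_pdivlMr//.
  rewrite [leRHS](_ : _ = ((eta / K) `^ tau^-1) `^ tau); last first.
    by rewrite -powRrM mulVf ?gt_eqF// powRr1// ltW// divr_gt0.
  by apply: ge0_ler_powR; rewrite ?nnegrE ?powR_ge0 ?(ltW ta0)// (ltW heta).
have unit_step : armijo y e 0.
  rewrite /Defs.armijo gradient_thetaE// expr0 scale1r mulr1.
  have -> : y + e = yhat + h' by rewrite /h' /h addrA [yhat + _]addrC subrK.
  have /andP[_ ub] := quad yhat h'; rewrite ghat0 dot0l addr0 in ub.
  apply: (le_trans ub).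
  rewrite thE -gE.
  have -> : e = h' - h by rewrite /h' addrC addKr.
  rewrite dotDr dotNr (dotC (grad y) h).
  have q_ge : c * dot h h <= dot h (grad y) by rewrite gE; exact: Vc.
  have gh' : dot (grad y) h' >= - (C * N * (eta * N)).
    apply: le_trans (dot_ge_enorm _ _); rewrite lerN2.
    by apply: ler_pM; rewrite ?enorm_ge0.
  have h'h' : dot h' h' <= (eta * N) ^+ 2.
    by rewrite -enorm_sqr ler_sqr ?nnegrE ?enorm_ge0// (le_trans (enorm_ge0 h')).
  have eta1 : eta <= 1 by rewrite ge_min lexx.
  have etaC : C * eta <= (2^-1 - mu) * c.
    by rewrite mulrC -ler_pdivlMr// ge_min lexx orbT.
  rewrite -enorm_sqr -/N in q_ge.
  rewrite -addrA lerD2l; apply: (@unit_step_model _ _ C c eta N) => //.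
  by rewrite (ltW eta0) eta1.
have l0 : l = 0%N by case: l nolt {arm} => // l /(_ 0%N isT).
rewrite l0 expr0 scale1r addrAC -/h -/h'; split=> //.
apply: le_trans small _; rewrite ler_piMl//.
by rewrite ge_min lexx.
Qed.

End Convergence.

Theorem theorem5 (R : realType) (m n s : nat)
    (A : 'M[R]_(m, n)) (b : 'cV[R]_m) (B : 'M[R]_(s, n)) (d : 'cV[R]_s)
    (lambda sigma : R) (x : 'cV[R]_n)
    (mu etabar tau tau1 tau2 delta : R)
    (y : nat -> 'cV[R]_(m + s)) (yhat : 'cV[R]_(m + s)) :
  0 < lambda -> 0 < sigma ->
  0 < mu < 2^-1 -> 0 < etabar < 1 -> 0 < tau <= 1 ->
  0 < tau1 < 1 -> 0 < tau2 < 1 -> 0 < delta < 1 ->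
  ssn_sequence A b B d lambda sigma x mu etabar tau tau1 tau2 delta y ->
  cluster (y @ \oo) yhat ->
  constraint_nondegenerate B lambda sigma (prox_arg A B sigma x yhat) ->
  y @ \oo --> yhat /\
  (fun j : nat => enorm (y j.+1 - yhat) : R^o) =O_\oo
    (fun j : nat => enorm (y j - yhat) `^ (1 + tau) : R^o).
Proof.
move=> lambda0 sigma0 hmu heta htau htau1 htau2 hdelta steps yyhat nondeg.
have freq := frequently_near yyhat.
have ghat0 : theta_grad A b B d lambda sigma x yhat = 0.
  exact: ssn_cluster_stationary steps yyhat.
have [rho rho0 [K K0 local]] :=
  ssn_local_step etabar delta lambda0 sigma0 hmu htau htau1 htau2 nondeg ghat0.
have stay N j : enorm (y N - yhat) < rho -> (N <= j)%N ->
    enorm (y j - yhat) <= enorm (y N - yhat).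
  move=> Nrho; elim: j => [|j IH]; first by rewrite leqn0 => /eqP ->.
  rewrite leq_eqVlt => /orP[/eqP ->//|/IH jN]; apply: le_trans (jN).
  by have [] := local _ _ (le_lt_trans jN Nrho) (steps j).
split.
  apply: cvg_of_enorm => r r0.
  have [|N _] := freq (Num.min rho r) 0%N; first by rewrite lt_min rho0.
  rewrite lt_min => /andP[Nrho Nr]; exists N => j Nj.
  exact: le_lt_trans (stay N j Nrho Nj) Nr.
have [N _ Nrho] := freq rho 0%N rho0.
apply/eqO_exP; exists K => //; exists N => // j /= Nj.
rewrite !ger0_norm ?enorm_ge0 ?powR_ge0//.
by have [] := local _ _ (le_lt_trans (stay N j Nrho Nj) Nrho) (steps j).
Qed.
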